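(* Let $\Omega\subset\mathbb{R}^d$ be a bounded open set, let $q\ge 1$ be an integer, let $\lambda\in\mathbb{R}\setminus\{0\}$, let $k\in C^q(\overline{\Omega}\times\overline{\Omega})$ and let $f\in C^q(\overline{\Omega})$ be a nonzero function. Assume: (1) $\lambda$ does not belong to the spectrum of the integral operator $\mathcal{K}\colon C^0(\overline{\Omega})\to C^0(\overline{\Omega})$, $(\mathcal{K}v)(x)=\int_\Omega k(x,y)v(y)\,dy$; let $u\in C^q(\overline{\Omega})$ denote the unique solution of $\lambda u(x)-\int_\Omega k(x,y)u(y)\,dy=f(x)$, $x\in\Omega$. (2) The quadrature scheme $\{(Y_{\vec h},\vec w_{\vec h})\}$ is stable with constant $C_Q$ and convergent with order $q_w$, where $0<q_w\le q$, with constant $C_w$. (3) The reconstruction scheme $\{(X_{\vec h},Y_{\vec h},R_{\vec h})\}$ is stable and convergent with order $q_R$, where $0<q_R\le q$, with constant $C_R$. Then there exist $\delta>0$ and a constant $C>0$ independent of $h_X,h_Y$ such that for all $h_X,h_Y\in(0,\delta)$: the linear system \[ A_{\vec h}\hat{\vec u}_{\vec h}:=(\lambda I_{\vec h}-K_{\vec h}W_{\vec h}R_{\vec h})\hat{\vec u}_{\vec h}=f|_{X_{\vec h}} \] has a unique solution; the condition number of $A_{\vec h}$ in the $\infty$-norm is bounded independently of $\vec h$; and the Nyström interpolant \[ u_{\vec h}(x)=\frac{1}{\lambda}\Big(\sum_{i=1}^{|Y_{\vec h}|} w_{\vec h,i}\,k(x,y_{\vec h,i})\sum_{j=1}^{|X_{\vec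 h}|}(R_{\vec h})_{ij}\hat u_{\vec h,j}+f(x)\Big) \] satisfies \[ \|u-u_{\vec h}\|_\infty\le C\Big(C_w\,\max_{x\in\overline{\Omega}}\|k(x,\cdot)\|_{C^q(\overline{\Omega})}\,h_Y^{q_w}+C_QC_R\,\|k\|_{C^0(\overline{\Omega}\times\overline{\Omega})}\,h_X^{q_R}\Big)\|u\|_{C^q(\overline{\Omega})}. \]
   Context: For an integer $m\ge0$, $C^m(\overline{\Omega})$ is the space of functions on $\Omega$ whose partial derivatives $\partial^\alpha v$, $|\alpha|\le m$, exist, are continuous on $\Omega$ and extend continuously to $\overline{\Omega}$, normed by $\|v\|_{C^m(\overline{\Omega})}=\sum_{|\alpha|\le m}\frac{1}{\alpha!}\max_{x\in\overline{\Omega}}|\partial^\alpha v(x)|$ (multi-index notation, $\alpha!=\prod\alpha_i!$); $\|v\|_\infty=\max_{\overline\Omega}|v|$, and $\|k\|_{C^0(\overline\Omega\times\overline\Omega)}=\max|k|$. Here $\vec h=(h_X,h_Y)$ with $h_X,h_Y>0$. A quadrature scheme is a family $\{(Y_{\vec h},\vec w_{\vec h})\}$ of finite node sets $Y_{\vec h}=\{y_{\vec h,i}\}\subset\overline{\Omega}$ and weights $\vec w_{\vec h}\in\mathbb{R}^{|Y_{\vec h}|}$ depending only on $h_Y$, with $|Y_{\vec h}|\to\infty$ as $h_Y\to0^+$. It is stable if $\|\vec w_{\vec h}\|_1\le C_Q$ for all $\vec h$, and convergent with order $q_w$ if $|\int_\Omega v-\sum_i w_{\vec h,i}v(y_{\vec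 h,i})|\le C_w h_Y^{q_w}\|v\|_{C^{q_w}(\overline{\Omega})}$ for all $\vec h$ and all $v\in C^{q_w}(\overline{\Omega})$. A reconstruction scheme is a family of triples $(X_{\vec h},Y_{\vec h},R_{\vec h})$, $h_X,h_Y>0$, where $X_{\vec h}=\{x_{\vec h,j}\}\subset\overline{\Omega}$ is a finite set depending only on $h_X$ (solution nodes), $Y_{\vec h}$ are the quadrature nodes above, and $R_{\vec h}$ is a real $|Y_{\vec h}|\times|X_{\vec h}|$ matrix. It is stable if $\|R_{\vec h}\|_\infty\le C_I$ (max absolute row sum) for all $\vec h$, and convergent with order $q_R$ if $\|v|_{Y_{\vec h}}-R_{\vec h}v|_{X_{\vec h}}\|_\infty\le C_R h_X^{q_R}\|v\|_{C^{q_R}(\overline{\Omega})}$ for all $\vec h$ and all $v\in C^{q_R}(\overline{\Omega})$, where $v|_S$ denotes the vector of values of $v$ at the points of $S$. $I_{\vec h}$ is the $|X_{\vec h}|\times|X_{\vec h}|$ identity, $(K_{\vec h})_{ij}=k(x_{\vec h,i},y_{\vec h,j})$, $W_{\vec h}=\mathrm{diag}(\vec w_{\vec h})$. *)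

(* Defs.v *)
From HB Require Import structures.
From mathcomp Require Import all_boot all_order all_algebra.
From mathcomp Require Import all_classical all_reals all_analysis.
Set Implicit Arguments. Unset Strict Implicit. Unset Printing Implicit Defensive.
Import Order.TTheory GRing.Theory Num.Theory.
Import numFieldNormedType.Exports.
Local Open Scope classical_set_scope.
Local Open Scope ring_scope.

Section NystromDefs.
Variable R : realType.

(* Iterated Lebesgue integral over R^d = 'rV[R]_d (equal, by Fubini, to the
   d-dimensional Lebesgue integral for the integrands used here). *)
Fixpoint iter_int (d : nat) : ('rV[R]_d -> R) -> R :=
  match d return ('rV[R]_d -> R) -> R with
  | 0 => fun g => g 0
  | n.+1 => fun g =>
      \int[@lebesgue_measure R]_(t in [set: R])
         iter_int (fun z : 'rV[R]_n => g (row_mx (const_mx t : 'rV[R]_1) z))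
  end.

Definition int_over (d : nat) (O : set 'rV[R]_d) (v : 'rV[R]_d -> R) : R :=
  iter_int (fun z => if z \in O then v z else 0).

Definition intop (d : nat) (O : set 'rV[R]_d) (k : 'rV[R]_d -> 'rV[R]_d -> R)
  (v : 'rV[R]_d -> R) : 'rV[R]_d -> R :=
  fun x => int_over O (fun y => k x y * v y).

Definition unitvec (d : nat) (i : 'I_d) : 'rV[R]_d := delta_mx 0 i.

Definition pderiv (d : nat) (i : 'I_d) (g : 'rV[R]_d -> R) : 'rV[R]_d -> R :=
  fun x => 'D_(unitvec i) g x.

Definition Dseq (d : nat) (s : seq 'I_d) (g : 'rV[R]_d -> R) : 'rV[R]_d -> R :=
  foldr (@pderiv d) g s.

Definition Dalpha (d : nat) (a : 'I_d -> nat) (g : 'rV[R]_d -> R) :=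
  Dseq (flatten [seq nseq (a i) i | i <- enum 'I_d]) g.

Definition Cm (d : nat) (m : nat) (O : set 'rV[R]_d) (v : 'rV[R]_d -> R) : Prop :=
  {within closure O, continuous v} /\
  (forall (s : seq 'I_d) (i : 'I_d) (x : 'rV[R]_d), (size s < m)%N -> O x ->
      derivable (Dseq s v) x (unitvec i)) /\
  (forall s : seq 'I_d, (size s <= m)%N ->
      (forall x, O x -> {for x, continuous (Dseq s v)}) /\
      exists g : 'rV[R]_d -> R, {within closure O, continuous g} /\
                                forall x, O x -> g x = Dseq s v x).

(* max over closure Omega of |g|, where g (a derivative of v) is identified
   with its continuous extension: realised as the sup over Omega. *)
Definition supnorm_on (T : Type) (A : set T) (g : T -> R) : R :=
  sup [set `|g x| | x in A].

Definition Cnorm (d : nat) (m : nat) (O : set 'rV[R]_d) (v : 'rV[R]_d -> R) : R :=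
  \sum_(a : {ffun 'I_d -> 'I_m.+1} | (\sum_(i < d) (a i : nat) <= m)%N)
     (\prod_(i < d) ((a i : nat)`!)%:R)^-1 *
       supnorm_on O (Dalpha (fun i => (a i : nat)) v).

(* kernels on closure(Omega) x closure(Omega) = closure(Omega x Omega),
   viewed as functions on R^(d+d) *)
Definition kjoin (d : nat) (k : 'rV[R]_d -> 'rV[R]_d -> R) : 'rV[R]_(d + d) -> R :=
  fun z => k (lsubmx z) (rsubmx z).
Definition prodset (d : nat) (O : set 'rV[R]_d) : set 'rV[R]_(d + d) :=
  [set z | O (lsubmx z) /\ O (rsubmx z)].

Definition Cm_kernel (d : nat) (m : nat) (O : set 'rV[R]_d)
  (k : 'rV[R]_d -> 'rV[R]_d -> R) : Prop := Cm m (prodset O) (kjoin k).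

Definition kC0norm (d : nat) (O : set 'rV[R]_d) (k : 'rV[R]_d -> 'rV[R]_d -> R) : R :=
  sup [set `|k p.1 p.2| | p in closure O `*` closure O].

Definition kCm_sup (d : nat) (m : nat) (O : set 'rV[R]_d)
  (k : 'rV[R]_d -> 'rV[R]_d -> R) : R :=
  sup [set Cnorm m O (k x) | x in closure O].

(* lambda is not in the spectrum of K on C^0(closure Omega):
   lambda I - K is a bijection of C^0(closure Omega) onto itself
   (bounded inverse is then automatic by the open mapping theorem). *)
Definition not_in_spectrum (d : nat) (O : set 'rV[R]_d)
  (k : 'rV[R]_d -> 'rV[R]_d -> R) (lam : R) : Prop :=
  forall g : 'rV[R]_d -> R, {within closure O, continuous g} ->
    exists v : 'rV[R]_d -> R,
      [/\ {within closure O, continuous v},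
          (forall x, closure O x -> lam * v x - intop O k v x = g x) &
          forall v' : 'rV[R]_d -> R, {within closure O, continuous v'} ->
            (forall x, closure O x -> lam * v' x - intop O k v' x = g x) ->
            forall x, closure O x -> v' x = v x].

Definition mxnorm_inf (m n : nat) (A : 'M[R]_(m, n)) : R :=
  \big[Num.max/0]_(i < m) \sum_(j < n) `|A i j|.

Definition cond_inf (n : nat) (A : 'M[R]_n) : R :=
  mxnorm_inf A * mxnorm_inf (invmx A).

Definition quad_scheme (d : nat) (O : set 'rV[R]_d) (nY : R -> nat)
  (y : forall hY : R, 'I_(nY hY) -> 'rV[R]_d) (w : forall hY : R, 'I_(nY hY) -> R) : Prop :=
  (forall hY, 0 < hY -> injective (y hY) /\ forall i, closure O (y hY i)) /\
  (forall N : nat, exists2 e : R, 0 < e & forall hY, 0 < hY < e -> (N <= nY hY)%N).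

Definition quad_stable (nY : R -> nat) (w : forall hY : R, 'I_(nY hY) -> R) (CQ : R) : Prop :=
  forall hY, 0 < hY -> \sum_(i < nY hY) `|w hY i| <= CQ.

Definition quad_convergent (d : nat) (O : set 'rV[R]_d) (nY : R -> nat)
  (y : forall hY : R, 'I_(nY hY) -> 'rV[R]_d) (w : forall hY : R, 'I_(nY hY) -> R)
  (qw : nat) (Cw : R) : Prop :=
  forall hY, 0 < hY -> forall v : 'rV[R]_d -> R, Cm qw O v ->
    `|int_over O v - \sum_(i < nY hY) w hY i * v (y hY i)|
      <= Cw * hY ^+ qw * Cnorm qw O v.

Definition node_set (d : nat) (O : set 'rV[R]_d) (nX : R -> nat)
  (x : forall hX : R, 'I_(nX hX) -> 'rV[R]_d) : Prop :=
  forall hX, 0 < hX -> injective (x hX) /\ forall j, closure O (x hX j).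

Definition restr (d n : nat) (p : 'I_n -> 'rV[R]_d) (v : 'rV[R]_d -> R) : 'cV[R]_n :=
  \col_(i < n) v (p i).

Definition recon_stable (nX nY : R -> nat)
  (Rm : forall hX hY : R, 'M[R]_(nY hY, nX hX)) (CI : R) : Prop :=
  forall hX hY, 0 < hX -> 0 < hY -> mxnorm_inf (Rm hX hY) <= CI.

Definition recon_convergent (d : nat) (O : set 'rV[R]_d) (nX nY : R -> nat)
  (x : forall hX : R, 'I_(nX hX) -> 'rV[R]_d)
  (y : forall hY : R, 'I_(nY hY) -> 'rV[R]_d)
  (Rm : forall hX hY : R, 'M[R]_(nY hY, nX hX)) (qR : nat) (CR : R) : Prop :=
  forall hX hY, 0 < hX -> 0 < hY -> forall v : 'rV[R]_d -> R, Cm qR O v ->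
    mxnorm_inf (restr (y hY) v - Rm hX hY *m restr (x hX) v)
      <= CR * hX ^+ qR * Cnorm qR O v.

Definition nystrom_matrix (d : nat) (k : 'rV[R]_d -> 'rV[R]_d -> R) (lam : R)
  (nx ny : nat) (x : 'I_nx -> 'rV[R]_d) (y : 'I_ny -> 'rV[R]_d) (w : 'I_ny -> R)
  (Rm : 'M[R]_(ny, nx)) : 'M[R]_nx :=
  lam%:M - (\matrix_(i < nx, j < ny) k (x i) (y j)) *m diag_mx (\row_(j < ny) w j) *m Rm.

Definition nystrom_interp (d : nat) (k : 'rV[R]_d -> 'rV[R]_d -> R) (f : 'rV[R]_d -> R)
  (lam : R) (nx ny : nat) (y : 'I_ny -> 'rV[R]_d) (w : 'I_ny -> R)
  (Rm : 'M[R]_(ny, nx)) (uhat : 'cV[R]_nx) : 'rV[R]_d -> R :=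
  fun z => lam^-1 * (\sum_(i < ny) w i * k z (y i) * (\sum_(j < nx) Rm i j * uhat j 0)
                     + f z).

End NystromDefs.

(* Main.v *)
(** On C^qw functions the integral is the limit of the quadrature sums, so it
    inherits the bound CQ * sup from the stability of the quadrature, and no
    measure theory is needed. The discrete operator applied to a vector v is
    z |-> L (k z) for a functional L bounded by CQ * CI * |v|; such a function
    is C^q with controlled norm, so quadrature and reconstruction converge on it.
    Hence lam * g - K g is small for g := L (k .) whenever A v is small. If v
    did not become small as well, an ultrafilter limit of the functionals L
    would produce a nonzero g with lam * g = K g (this replaces Arzela-Ascoli),
    contradicting the assumption on the spectrum. This bounds the inverses of the
    matrices A uniformly; the error estimate is then consistency, where the
    Leibniz rule bounds the C^qw norm of k(z, .) * u, plus stability. *)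
Require Import Defs.
From HB Require Import structures.
From mathcomp Require Import all_boot all_order all_algebra.
From mathcomp Require Import all_classical all_reals all_analysis.
From mathcomp Require Import ring lra.
Set Implicit Arguments. Unset Strict Implicit. Unset Printing Implicit Defensive.
Import Order.TTheory GRing.Theory Num.Theory.
Import numFieldNormedType.Exports.
Local Open Scope classical_set_scope.
Local Open Scope ring_scope.

(** * Epsilon-delta forms of closure and continuity, compactness, mean value estimate *)

Section EpsilonDelta.
Variables (R : realType).

(** The obstacle is that the bound [CQ] * sup on the integral is available only for C^qw functions,
    a class that uniform limits leave. This is why functionals and not functions are taken to the
    limit: a limit functional [L'] has the same bound as the [L n], so z |-> [L' (k z)] is again C^q
    and the integral bound still applies to its product with [k z]. For this, derivatives in z must
    pass through an arbitrary bounded functional acting in y, so the difference quotients of the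
    kernel have to converge uniformly in y up to the boundary. The continuous extensions of the
    derivatives of [k], together with compactness of the closure, provide that. Stability is proved
    on the unit ball only: if |v| <= 1 and |A v| is small, then |v| <= 3/4. Homogeneity turns this
    into a lower bound for A, hence into injectivity and a bound on the inverse. *)

Lemma closure_normP (V : normedModType R) (A : set V) (x : V) :
  closure A x <-> forall e : R, 0 < e -> exists2 a, A a & `|a - x| < e.
Proof.
split=> [clAx e e0|H B /nbhs_ballP[e /= e0 eB]].
  have [a [Aa ax]] := clAx _ (nbhsx_ballx x e e0).
  by exists a => //; move: ax; rewrite -ball_normE /= distrC.
have [a Aa ax] := H e e0; exists a; split => //; apply: eB.
by rewrite -ball_normE /= distrC.
Qed.

Lemma open_normP (V : normedModType R) (A : set V) (x : V) : open A -> A x ->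
  exists2 e : R, 0 < e & forall y, `|y - x| < e -> A y.
Proof.
move=> oA Ax; have /nbhs_ballP[e /= e0 eA] := open_nbhs_nbhs (conj oA Ax).
by exists e => // y yx; apply: eA; rewrite -ball_normE /= distrC.
Qed.

Lemma continuous_within_normP (V : normedModType R) (A : set V) (g : V -> R) :
  {within A, continuous g} <->
  forall x, A x -> forall e : R, 0 < e -> exists2 d : R, 0 < d &
    forall y, A y -> `|y - x| < d -> `|g y - g x| < e.
Proof.
split.
  move=> /subspace_continuousP cg x Ax e e0.
  have /cvgrPdist_lt /(_ e e0) := cg x Ax.
  rewrite near_withinE => /nbhs_ballP[d /= d0 dP].
  exists d => // y Ay yx; rewrite distrC; apply: dP => //.
  by rewrite -ball_normE /= distrC.
move=> H; apply/subspace_continuousP => x Ax.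
apply/cvgrPdist_lt => e e0; have [d d0 dP] := H x Ax e e0.
rewrite near_withinE; apply/nbhs_ballP; exists d => // y.
by rewrite -ball_normE /= distrC => yx Ay; rewrite distrC; exact: dP.
Qed.

Lemma continuous_within_open (V : normedModType R) (A : set V) (g : V -> R) x :
  open A -> {within closure A, continuous g} -> A x -> {for x, continuous g}.
Proof.
move=> oA /continuous_within_normP cg Ax.
have [d' d'0 d'A] := open_normP oA Ax.
apply/cvgrPdist_lt => e e0.
have [d d0 dP] := cg x (subset_closure Ax) e e0.
apply/nbhs_ballP; exists (Num.min d d') => /=; first by rewrite lt_min d0.
move=> y; rewrite -ball_normE /= distrC lt_min => /andP[yd yd'].
by rewrite distrC; apply: dP => //; apply/subset_closure/d'A.
Qed.

Lemma continuous_within_eq (V : normedModType R) (A : set V) (f g : V -> R) :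
  (forall x, A x -> f x = g x) -> {within A, continuous f} ->
  {within A, continuous g}.
Proof.
move=> fg /continuous_within_normP cf; apply/continuous_within_normP => x Ax e e0.
have [d d0 dP] := cf x Ax e e0; exists d => // y Ay yx.
by rewrite -!fg //; exact: dP.
Qed.

Lemma continuous_withinD (V : normedModType R) (A : set V) (f g : V -> R) :
  {within A, continuous f} -> {within A, continuous g} ->
  {within A, continuous (fun x => f x + g x)}.
Proof. by move=> cf cg x; apply: cvgD; [exact: cf|exact: cg]. Qed.

Lemma continuous_withinM (V : normedModType R) (A : set V) (f g : V -> R) :
  {within A, continuous f} -> {within A, continuous g} ->
  {within A, continuous (fun x => f x * g x)}.
Proof. by move=> cf cg x; apply: cvgM; [exact: cf|exact: cg]. Qed.

Lemma continuous_withinZ (V : normedModType R) (A : set V) (a : R) (f : V -> R) :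
  {within A, continuous f} -> {within A, continuous (fun x => a * f x)}.
Proof. by move=> cf x; apply: cvgMr; exact: cf. Qed.

Lemma closure_norm_le (V : normedModType R) (A : set V) (g : V -> R) (M : R) :
  {within closure A, continuous g} -> (forall x, A x -> `|g x| <= M) ->
  forall x, closure A x -> `|g x| <= M.
Proof.
move=> /continuous_within_normP cg gM x clx.
apply/ler_addgt0Pr => e e0; have [d d0 dP] := cg x clx e e0.
have /closure_normP/(_ d d0)[a Aa ax] := clx.
rewrite -(subrK (g a) (g x)) addrC (le_trans (ler_normD _ _))// lerD//.
  exact: gM.
by rewrite distrC ltW// dP//; exact: subset_closure.
Qed.

(** Finite subcovers enter as a near covering along the filter [+oo] of bounds: a local bound M at x
    serves a ball around x and, by monotonicity, every larger M'. *)
Lemma compact_exists_bound (V : normedModType R) (A : set V)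
    (P : R -> V -> Prop) :
  compact A -> (forall M M' x, M <= M' -> P M x -> P M' x) ->
  (forall x, A x -> exists2 d : R, 0 < d &
     exists M, forall y, A y -> `|y - x| < d -> P M y) ->
  exists M, forall x, A x -> P M x.
Proof.
move=> cA Pmono Ploc.
have /compact_near_coveringP/near_covering_withinP cov := cA.
have [M [_ HM]] : \forall M \near +oo, A `<=` P M.
  apply: cov => x Ax; have [d d0 [M HM]] := Ploc x Ax.
  exists (ball x d, [set M' | M < M']) => /=.
    by split; [exact: nbhsx_ballx|exists M; split => //; exact: num_real].
  move=> [y M'] /= [yx MM'] Ay; apply: (Pmono M); first exact: ltW.
  by apply: HM => //; move: yx; rewrite -ball_normE /= distrC.
by exists (M + 1); apply: HM; rewrite ltrDl.
Qed.

Lemma compact_closure_rV (d : nat) (O : set 'rV[R]_d) :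
  bounded_set O -> compact (closure O).
Proof.
move=> [M [Mr HM]]; apply: bounded_closed_compact; last exact: closed_closure.
exists (M + 2); split; first exact: num_real.
move=> M' MM' x clx.
have /closure_normP/(_ 1 ltr01)[a Oa ax] := clx.
have := HM (M + 1) _ a Oa; rewrite ltrDl ltr01 => /(_ isT) /= aM.
rewrite -(subrK a x) (le_trans (ler_normD _ _))//.
by move: ax; rewrite distrC => ax; lra.
Qed.

Lemma continuous_closure_bounded (d : nat) (O : set 'rV[R]_d) (g : 'rV[R]_d -> R) :
  bounded_set O -> {within closure O, continuous g} ->
  exists M, forall x, closure O x -> `|g x| <= M.
Proof.
move=> bO /continuous_within_normP cg.
apply: (@compact_exists_bound _ _ (fun M x => `|g x| <= M)).
- exact: compact_closure_rV.
- by move=> M M' x MM' /le_trans; apply.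
move=> x clx; have [e e0 eP] := cg x clx 1 ltr01.
exists e => //; exists (`|g x| + 1) => y cly yx.
have := eP y cly yx; rewrite -{2}(subrK (g x) (g y)) => h.
by rewrite (le_trans (ler_normD _ _))// addrC lerD2l ltW.
Qed.

(** The remainder equals (dphi x - c) * t at an intermediate point x. Radius and error are explicit,
    so that one choice serves a whole family of functions [phi]. *)
Lemma mean_value_remainder (phi dphi : R -> R) (r c e : R) :
  (forall t : R, `|t| < r -> is_derive t 1 phi (dphi t)) ->
  (forall t : R, `|t| < r -> `|dphi t - c| <= e) ->
  forall t : R, `|t| < r -> `|phi t - phi 0 - t * c| <= e * `|t|.
Proof.
move=> dP ce.
have mvt a b : a <= b -> (forall t, a <= t <= b -> `|t| < r) ->
    `|phi b - phi a - (b - a) * c| <= e * (b - a).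
  move=> ab abr.
  have [||x xab ->] := @MVT_segment R phi dphi a b ab.
  - move=> x; rewrite in_itv /= => /andP[ax xb]; apply: dP; apply: abr.
    by rewrite !ltW.
  - apply: derivable_within_continuous => x; rewrite in_itv /= => xab.
    by have [] := dP x (abr x xab).
  rewrite (mulrC (b - a) c) -mulrBl normrM (@ger0_norm _ (b - a)) ?subr_ge0//.
  apply: ler_wpM2r; first by rewrite subr_ge0.
  by apply: ce; apply: abr; move: xab; rewrite in_itv.
move=> t tr; have [t0|t0] := leP 0 t.
  rewrite [in leRHS]ger0_norm//; have := mvt 0 t t0; rewrite subr0 => -> //.
  move=> s /andP[s0 st]; rewrite ger0_norm//.
  by rewrite (le_lt_trans st)// (le_lt_trans (ler_norm t)).
have := mvt t 0 (ltW t0).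
rewrite -normrN sub0r -(ltr0_norm t0) => H.
rewrite (_ : _ - _ = - (phi 0 - phi t - `|t| * c)) ?H//; last first.
  by rewrite ltr0_norm//; ring.
move=> s /andP[ts s0]; rewrite ler0_norm//.
by rewrite (le_lt_trans _ tr)// ltr0_norm// lerN2.
Qed.

End EpsilonDelta.

(** * Kernels whose derivatives in one variable extend continuously to the closure *)

Section KernelFamilies.
Variables (R : realType).

Lemma mx_norm_ltP (m n : nat) (A : 'M[R]_(m, n)) (e : R) : 0 < e ->
  `|A| < e <-> forall i j, `|A i j| < e.
Proof.
move=> e0; rewrite /Num.norm /= mx_normrE; split.
  by move=> /bigmax_ltP[_ H] i j; exact: (H (i, j)).
by move=> H; apply/bigmax_ltP; split => // -[i j] _; exact: H.
Qed.

Lemma norm_unitvec_le1 (d : nat) (i : 'I_d) : `|unitvec R i| <= 1.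
Proof.
rewrite /Num.norm /= mx_normrE; apply/bigmax_leP; split => // -[a b] _ /=.
by rewrite mxE; case: (_ && _); rewrite ?normr1 ?normr0.
Qed.

Lemma row_mx_norm_lt (m n : nat) (a a' : 'rV[R]_m) (b b' : 'rV[R]_n) (e : R) :
  `|a - a'| < e -> `|b - b'| < e -> `|row_mx a b - row_mx a' b'| < e.
Proof.
move=> ae be; have e0 : 0 < e by apply: le_lt_trans ae.
move/(mx_norm_ltP _ e0) : ae => ae; move/(mx_norm_ltP _ e0) : be => be.
rewrite opp_row_mx add_row_mx; apply/mx_norm_ltP => // i j.
by rewrite mxE; case: splitP => j' _; [exact: ae|exact: be].
Qed.

Definition jointly_continuous (d : nat) (O : set 'rV[R]_d)
    (G : 'rV[R]_d -> 'rV[R]_d -> R) :=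
  forall z y, closure O z -> closure O y -> forall e : R, 0 < e ->
  exists2 r : R, 0 < r & forall z' y', closure O z' -> closure O y' ->
    `|z' - z| < r -> `|y' - y| < r -> `|G z' y' - G z y| < e.

(* [G s z y] is the continuous extension to the closure of the derivative of
   [k] along the directions [s] of the first variable. *)
Definition kernel_derivatives (d q : nat) (O : set 'rV[R]_d)
    (k : 'rV[R]_d -> 'rV[R]_d -> R)
    (G : seq 'I_d -> 'rV[R]_d -> 'rV[R]_d -> R) :=
  [/\ G [::] = k,
      forall s, (size s <= q)%N -> jointly_continuous O (G s) &
      forall s i z y, (size s < q)%N -> O z -> O y ->
        is_derive z (unitvec R i) (fun z' => G s z' y) (G (i :: s) z y)].

Lemma jointly_continuousr (d : nat) (O : set 'rV[R]_d) G z :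
  jointly_continuous O G -> closure O z -> {within closure O, continuous (G z)}.
Proof.
move=> jG clz; apply/continuous_within_normP => y cly e e0.
have [r r0 rP] := jG z y clz cly e e0; exists r => // y' cly' yy'.
by apply: rP => //; rewrite subrr normr0.
Qed.

Lemma jointly_continuous_unif (d : nat) (O : set 'rV[R]_d) G z (e : R) :
  bounded_set O -> jointly_continuous O G -> closure O z -> 0 < e ->
  exists2 r : R, 0 < r & forall z', closure O z' -> `|z' - z| < r ->
    forall y, closure O y -> `|G z' y - G z y| <= e.
Proof.
move=> bO jG clz e0.
(* M is the inverse of the radius, so that [P] weakens as M grows, which is the monotonicity that
   [compact_exists_bound] asks for. *)
pose P (M : R) y := 0 < M /\ forall z', closure O z' -> `|z' - z| < M^-1 ->
  `|G z' y - G z y| <= e.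
have [M HM] : exists M, forall y, closure O y -> P M y.
  apply: compact_exists_bound; first exact: compact_closure_rV.
    move=> M M' y MM' [M0 PM]; have M'0 := lt_le_trans M0 MM'; split => //.
    move=> z' clz' zz'; apply: PM => //; apply: lt_le_trans zz' _.
    by rewrite lef_pV2.
  move=> y cly; have e20 : 0 < e / 2 by lra.
  have [r r0 rP] := jG z y clz cly _ e20.
  exists r => //; exists r^-1 => y' cly' yy'; split; first by rewrite invr_gt0.
  move=> z' clz'; rewrite invrK => zz'.
  have h1 := rP z' y' clz' cly' zz' yy'.
  have h2 : `|G z y' - G z y| < e / 2 by apply: rP => //; rewrite subrr normr0.
  rewrite -(subrK (G z y) (G z' y')) -addrA (le_trans (ler_normD _ _))//.
  rewrite (splitr e) lerD//; first exact: ltW.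
  by rewrite distrC ltW.
have [M0 _] := HM z clz.
exists M^-1; first by rewrite invr_gt0.
by move=> z' clz' zz' y cly; have [_] := HM y cly; exact.
Qed.

Lemma jointly_continuous_bounded (d : nat) (O : set 'rV[R]_d) G :
  bounded_set O -> jointly_continuous O G ->
  exists M, forall z y, closure O z -> closure O y -> `|G z y| <= M.
Proof.
move=> bO jG.
have [M HM] : exists M, forall z, closure O z ->
    forall y, closure O y -> `|G z y| <= M.
  apply: (@compact_exists_bound _ _ _ (fun M z => forall y, closure O y -> `|G z y| <= M)).
  - exact: compact_closure_rV.
  - by move=> M M' z MM' HM y cly; rewrite (le_trans (HM y cly)).
  move=> z clz; have [r r0 rP] := jointly_continuous_unif bO jG clz ltr01.
  have [M HM] := continuous_closure_bounded bO (jointly_continuousr jG clz).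
  exists r => //; exists (1 + M) => z' clz' zz' y cly.
  rewrite -(subrK (G z y) (G z' y)) (le_trans (ler_normD _ _))// lerD//.
    exact: rP.
  exact: HM.
by exists M => z y clz; exact: HM.
Qed.

Lemma is_derive_line (V : normedModType R) (f : V -> R) (z v : V) (t : R) df :
  is_derive (t *: v + z) v f df ->
  is_derive t 1 (fun h : R => f (h *: v + z)) df.
Proof.
have E : (fun h : R => h^-1 *: (((fun h : R => f (h *: v + z)) \o shift t) (h *: 1) -
      f (t *: v + z))) =
    (fun h : R => h^-1 *: ((f \o shift (t *: v + z)) (h *: v) - f (t *: v + z))).
  by apply/funext => h /=; rewrite [_ *: 1]mulr1 scalerDl addrA.
by move=> [df1 df2]; split; rewrite /derivable/derive/= in df1 df2 *; rewrite E.
Qed.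

(** The mean value estimate along the i-th direction has a radius independent of y, because the next
    derivative is continuous in z uniformly in y. The estimate is proved for y in [O] and carried to
    the closure by continuity. *)
Lemma kernel_derivative_remainder (d q : nat) (O : set 'rV[R]_d) k G s i z (e : R) :
  bounded_set O -> open O -> kernel_derivatives q O k G ->
  (size s < q)%N -> O z -> 0 < e ->
  exists2 r : R, 0 < r & forall t : R, `|t| < r ->
    O (t *: unitvec R i + z) /\ forall y, closure O y ->
    `|G s (t *: unitvec R i + z) y - G s z y - t * G (i :: s) z y| <= e * `|t|.
Proof.
move=> bO oO [_ jG dG] sq Oz e0.
have [r1 r10 r1P] := open_normP oO Oz.
have [r2 r20 r2P] := jointly_continuous_unif bO (jG (i :: s) sq) (subset_closure Oz) e0.
have tv t : `|t| < Num.min r1 r2 -> O (t *: unitvec R i + z) /\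
    `|t *: unitvec R i + z - z| < r2.
  rewrite lt_min addrK => /andP[t1 t2].
  have tle : `|t *: unitvec R i| <= `|t|.
    rewrite normrZ -[leRHS]mulr1; apply: ler_wpM2l => //.
    exact: norm_unitvec_le1.
  by split; [apply: r1P; rewrite addrK|]; exact: le_lt_trans tle _.
exists (Num.min r1 r2); first by rewrite lt_min r10.
move=> t tr; split; first by have [] := tv t tr.
have Oclt : O (t *: unitvec R i + z) by have [] := tv t tr.
apply: closure_norm_le => [|y Oy].
  have jGs := jG s (ltnW sq).
  have c1 := jointly_continuousr jGs (subset_closure Oclt).
  have c2 := jointly_continuousr jGs (subset_closure Oz).
  have c3 := jointly_continuousr (jG (i :: s) sq) (subset_closure Oz).
  apply: continuous_within_eq _ (continuous_withinD (continuous_withinD c1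
    (continuous_withinZ (a := -1) c2)) (continuous_withinZ (a := - t) c3)) => y _.
  by ring.
have := @mean_value_remainder R (fun h => G s (h *: unitvec R i + z) y)
  (fun h => G (i :: s) (h *: unitvec R i + z) y) (Num.min r1 r2)
  (G (i :: s) z y) e.
rewrite scale0r add0r; apply => //.
  by move=> h hr; apply: (@is_derive_line _ (fun z' => G s z' y));
    apply: dG => //; have [] := tv h hr.
move=> h hr; have [Oh hr2] := tv h hr.
by apply: r2P => //; exact: subset_closure.
Qed.

(* [iota] embeds pairs of points into R^(d+d) with either order of the blocks,
   so that the derivatives in both variables are obtained at once. *)
Lemma Cm_kernel_derivatives (d q : nat) (O : set 'rV[R]_d)
    (k k' : 'rV[R]_d -> 'rV[R]_d -> R)
    (iota : 'rV[R]_d -> 'rV[R]_d -> 'rV[R]_(d + d)) (sigma : 'I_d -> 'I_(d + d)) :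
  open O -> Cm_kernel q O k ->
  (forall z y, O z -> O y -> prodset O (iota z y)) ->
  (forall z y z' y' e, `|z' - z| < e -> `|y' - y| < e ->
     `|iota z' y' - iota z y| < e) ->
  (forall t i z y, iota (t *: unitvec R i + z) y =
     t *: unitvec R (sigma i) + iota z y) ->
  (forall z y, kjoin k (iota z y) = k' z y) ->
  exists G, kernel_derivatives q O k' G.
Proof.
move=> oO [ck [dk ek]] iO inorm ishift ik.
(* For the empty sequence the extension is [kjoin k] itself, so that [G [::]] equals the kernel on
   the whole space; sequences longer than q get the default 0. *)
have /choice[g gP] : forall s : seq 'I_(d + d), exists g : 'rV[R]_(d + d) -> R,
    (size s <= q)%N -> [/\ {within closure (prodset O), continuous g},
      forall x, prodset O x -> g x = Dseq s (kjoin k) x &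
      s = [::] -> g = kjoin k].
  move=> s; have [sq|sq] := leqP (size s) q; last by exists (fun=> 0).
  case: s sq => [|i s] sq; first by exists (kjoin k).
  by have [_ [g [cg gE]]] := ek _ sq; exists g.
have icl z y : closure O z -> closure O y -> closure (prodset O) (iota z y).
  move=> /closure_normP clz /closure_normP cly; apply/closure_normP => e e0.
  have [a Oa az] := clz e e0; have [b Ob bz] := cly e e0.
  by exists (iota a b); [exact: iO|exact: inorm].
exists (fun s z y => g (map sigma s) (iota z y)); split.
- apply/funext => z; apply/funext => y.
  by have [//|_ _ ->] := gP [::]; first exact: ik.
- move=> s sq z y clz cly e e0.
  have [|/continuous_within_normP cg _ _] := gP (map sigma s).
    by rewrite size_map.
  have [r r0 rP] := cg _ (icl _ _ clz cly) e e0.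
  by exists r => // z' y' clz' cly' zz' yy'; apply: rP; [exact: icl|exact: inorm].
- move=> s i z y sq Oz Oy.
  have [|_ gs _] := gP (map sigma s); first by rewrite size_map ltnW.
  have [|_ gis _] := gP (map sigma (i :: s)); first by rewrite size_map.
  have Oiz := iO _ _ Oz Oy.
  have smq : (size (map sigma s) < q)%N by rewrite size_map.
  have dD := dk (map sigma s) (sigma i) (iota z y) smq Oiz.
  apply: (@near_eq_is_derive _ _ _ (fun z' => Dseq (map sigma s) (kjoin k) (iota z' y))).
    have [r r0 rP] := open_normP oO Oz.
    apply/nbhs_ballP; exists r => //= z'; rewrite -ball_normE /= distrC => zz'.
    by rewrite gs//; apply: iO => //; exact: rP.
  rewrite gis//.
  have E : (fun h : R => h^-1 *: (((fun z' => Dseq (map sigma s) (kjoin k) (iota z' y)) \o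
        shift z) (h *: unitvec R i) - Dseq (map sigma s) (kjoin k) (iota z y))) =
      (fun h : R => h^-1 *: ((Dseq (map sigma s) (kjoin k) \o shift (iota z y))
        (h *: unitvec R (sigma i)) - Dseq (map sigma s) (kjoin k) (iota z y))).
    by apply/funext => h /=; rewrite ishift.
  by split; rewrite /derivable/derive/= in dD *; rewrite E.
Qed.

Lemma unitvec_lshift (d : nat) (i : 'I_d) :
  unitvec R (lshift d i) = row_mx (unitvec R i) 0.
Proof.
apply/rowP => j; rewrite !mxE /=; case: splitP => j' jj'.
  by rewrite !mxE /= -!val_eqE /= jj'.
by rewrite !mxE -val_eqE /= jj' gtn_eqF// ltn_addr.
Qed.

Lemma unitvec_rshift (d : nat) (i : 'I_d) :
  unitvec R (rshift d i) = row_mx 0 (unitvec R i).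
Proof.
apply/rowP => j; rewrite !mxE /=; case: splitP => j' jj'.
  by rewrite !mxE -val_eqE /= jj' ltn_eqF// ltn_addr.
by rewrite !mxE /= -!val_eqE /= jj' eqn_add2l.
Qed.

Lemma kernel_derivatives_left (d q : nat) (O : set 'rV[R]_d) k :
  open O -> Cm_kernel q O k -> exists G, kernel_derivatives q O k G.
Proof.
move=> oO ck; apply: (@Cm_kernel_derivatives _ _ _ k _ (fun z y => row_mx z y) (@lshift d d)) => //.
- by move=> z y Oz Oy; rewrite /prodset /= row_mxKl row_mxKr.
- by move=> *; exact: row_mx_norm_lt.
- by move=> t i z y; rewrite unitvec_lshift scale_row_mx add_row_mx scaler0 add0r.
- by move=> z y; rewrite /kjoin row_mxKl row_mxKr.
Qed.

Lemma kernel_derivatives_right (d q : nat) (O : set 'rV[R]_d) k :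
  open O -> Cm_kernel q O k ->
  exists G, kernel_derivatives q O (fun y z => k z y) G.
Proof.
move=> oO ck; apply: (@Cm_kernel_derivatives _ _ _ k _ (fun z y => row_mx y z) (@rshift d d)) => //.
- by move=> z y Oz Oy; rewrite /prodset /= row_mxKl row_mxKr.
- by move=> *; exact: row_mx_norm_lt.
- by move=> t i z y; rewrite unitvec_rshift scale_row_mx add_row_mx scaler0 add0r.
- by move=> z y; rewrite /kjoin row_mxKl row_mxKr.
Qed.

End KernelFamilies.

(** * Bounded functionals applied to a kernel commute with its derivatives *)

Section Functionals.
Variables (R : realType) (d : nat) (O : set 'rV[R]_d).
Hypotheses (bO : bounded_set O) (oO : open O).

Definition bounded_on_closure (phi : 'rV[R]_d -> R) :=
  exists M, forall y, closure O y -> `|phi y| <= M.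

(** An element of norm at most B in the dual of the bounded functions on the closure. Linearity is
    asked on bounded functions only, where limits along an ultrafilter exist. *)
Definition bounded_functional (B : R) (L : ('rV[R]_d -> R) -> R) :=
  (forall a phi psi, bounded_on_closure phi -> bounded_on_closure psi ->
     L (fun y => a * phi y + psi y) = a * L phi + L psi) /\
  (forall phi M, (forall y, closure O y -> `|phi y| <= M) -> `|L phi| <= B * M).

Lemma bounded_on_closureD a phi psi :
  bounded_on_closure phi -> bounded_on_closure psi ->
  bounded_on_closure (fun y => a * phi y + psi y).
Proof.
move=> [M HM] [N HN]; exists (`|a| * M + N) => y cly.
by rewrite (le_trans (ler_normD _ _))// lerD ?normrM ?ler_wpM2l ?HM ?HN.
Qed.

Lemma bounded_functional_dist B L phi psi M : bounded_functional B L ->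
  bounded_on_closure phi -> bounded_on_closure psi ->
  (forall y, closure O y -> `|phi y - psi y| <= M) -> `|L phi - L psi| <= B * M.
Proof.
move=> [linL bL] bphi bpsi HM; rewrite -mulN1r addrC -linL//.
by apply: bL => y cly; rewrite addrC mulN1r; exact: HM.
Qed.

Lemma jointly_continuous_bounded_row G z : jointly_continuous O G ->
  closure O z -> bounded_on_closure (G z).
Proof.
by move=> jG clz; apply: continuous_closure_bounded => //; exact: jointly_continuousr.
Qed.

Lemma functional_kernel_continuous B L G : bounded_functional B L ->
  jointly_continuous O G -> {within closure O, continuous (fun z => L (G z))}.
Proof.
move=> bL jG; apply/continuous_within_normP => z clz e e0.
(* The sign of B is unknown here; dividing by |B| + 1 covers every case. *)
have e'0 : 0 < e / (`|B| + 1) by rewrite divr_gt0// ltr_wpDl.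
have [r r0 rP] := jointly_continuous_unif bO jG clz e'0.
exists r => // z' clz' zz'.
apply: (@le_lt_trans _ _ (B * (e / (`|B| + 1)))).
  apply: (bounded_functional_dist bL); try exact: jointly_continuous_bounded_row.
  exact: rP.
rewrite mulrCA gtr_pMr// ltr_pdivrMr ?mul1r; last by rewrite ltr_wpDl.
by rewrite (le_lt_trans (ler_norm _))// ltrDl.
Qed.

(** The remainder of the difference quotient is at most e' * |h| for all y at once, so [L] maps it
    to at most B * e' * |h|. *)
Lemma functional_kernel_is_derive B L q k G s i z : bounded_functional B L ->
  kernel_derivatives q O k G -> (size s < q)%N -> O z ->
  is_derive z (unitvec R i) (fun z' => L (G s z')) (L (G (i :: s) z)).
Proof.
move=> bL kG sq Oz; have [_ jG _] := kG.
suff cv : (fun h : R => h^-1 *: (((fun z' => L (G s z')) \o shift z) (h *: unitvec R i) -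
    L (G s z))) @ 0^' --> L (G (i :: s) z).
  by split; [apply/cvg_ex; exists (L (G (i :: s) z))|exact: cvg_lim].
apply/cvgrPdist_lt => e e0.
have e'0 : 0 < e / (`|B| + 1) by rewrite divr_gt0// ltr_wpDl.
have [r r0 rP] := kernel_derivative_remainder i bO oO kG sq Oz e'0.
apply/nbhs_ballP; exists r => //= h; rewrite -ball_normE /= sub0r normrN => hr hn0.
have [Oh hP] := rP h hr.
have b1 : bounded_on_closure (G s (h *: unitvec R i + z)).
  by apply: jointly_continuous_bounded_row (jG _ (ltnW sq)) _; exact: subset_closure.
have b2 : bounded_on_closure (G s z).
  by apply: jointly_continuous_bounded_row (jG _ (ltnW sq)) _; exact: subset_closure.
have b3 : bounded_on_closure (G (i :: s) z).
  by apply: jointly_continuous_bounded_row (jG (i :: s) sq) _; exact: subset_closure.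
have [linL leL] := bL.
have : `|L (fun y => (- h) * G (i :: s) z y +
    (-1 * G s z y + G s (h *: unitvec R i + z) y))| <=
    B * (e / (`|B| + 1) * `|h|).
  apply: leL => y cly; rewrite (_ : - h * _ + _ =
    G s (h *: unitvec R i + z) y - G s z y - h * G (i :: s) z y); last by ring.
  exact: hP.
rewrite linL//; last exact: bounded_on_closureD.
rewrite linL// => H.
have h0 : 0 < `|h| by rewrite normr_gt0.
rewrite -(ltr_pM2l h0) -normrM mulrBr.
rewrite [h * (h^-1 *: _)](_ : _ = L (G s (h *: unitvec R i + z)) - L (G s z)); last first.
  by rewrite -[h^-1 *: _]/(h^-1 * _) mulrA divff ?mul1r.
rewrite -normrN; apply: le_lt_trans (_ : _ <= B * (e / (`|B| + 1) * `|h|)) _.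
  by move: H; congr (`|_| <= _); ring.
rewrite mulrA mulrC ltr_pM2l// mulrCA gtr_pMr// ltr_pdivrMr ?mul1r; last by rewrite ltr_wpDl.
by rewrite (le_lt_trans (ler_norm _))// ltrDl.
Qed.

Lemma functional_kernel_Dseq B L q k G s z : bounded_functional B L ->
  kernel_derivatives q O k G -> (size s <= q)%N -> O z ->
  Dseq s (fun z' => L (k z')) z = L (G s z).
Proof.
move=> bL kG; elim: s z => [|i s IH] z sq Oz /=; first by have [-> _ _] := kG.
have [_ <-] := functional_kernel_is_derive i bL kG sq Oz.
rewrite /pderiv; apply: near_eq_derive.
have [r r0 rP] := open_normP oO Oz.
apply/nbhs_ballP; exists r => //= z'; rewrite -ball_normE /= distrC => zz'.
by apply: IH; [exact: ltnW|exact: rP].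
Qed.

(** z |-> [L (G s z)] is continuous on the whole closure, hence is the extension required of the
    derivative along s. *)
Lemma functional_kernel_Cm B L q k G : bounded_functional B L ->
  kernel_derivatives q O k G -> Cm q O (fun z => L (k z)).
Proof.
move=> bL kG; have [G0 jG _] := kG; split.
  by rewrite -G0; apply: functional_kernel_continuous bL _; exact: jG.
have nearD s z : (size s <= q)%N -> O z ->
    \forall z' \near z, L (G s z') = Dseq s (fun z => L (k z)) z'.
  move=> sq Oz; have [r r0 rP] := open_normP oO Oz.
  apply/nbhs_ballP; exists r => //= z'; rewrite -ball_normE /= distrC => zz'.
  by rewrite (functional_kernel_Dseq bL kG)//; exact: rP.
split=> [s i z sq Oz|s sq].
  apply: near_eq_derivable (nearD s z (ltnW sq) Oz) _.
  by have [] := functional_kernel_is_derive i bL kG sq Oz.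
have cL := functional_kernel_continuous bL (jG s sq).
split=> [z Oz|].
  have := continuous_within_open oO cL Oz.
  rewrite /prop_for /continuous_at -(functional_kernel_Dseq bL kG sq Oz).
  exact: cvg_trans (near_eq_cvg (nearD s z sq Oz)).
exists (fun z => L (G s z)); split => // z Oz.
by rewrite (functional_kernel_Dseq bL kG).
Qed.

End Functionals.

(** * Products of C^m functions and comparison of C^m norms *)

Section Leibniz.
Variables (R : realType) (d : nat) (O : set 'rV[R]_d).
Hypotheses (bO : bounded_set O) (oO : open O).

Definition multi_seq (a : 'I_d -> nat) : seq 'I_d :=
  flatten [seq nseq (a i) i | i <- enum 'I_d].

Lemma size_multi_seq a : size (multi_seq a) = (\sum_(i < d) a i)%N.
Proof.
rewrite /multi_seq size_flatten sumnE /shape -map_comp big_map big_enum /=.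
by apply: eq_bigr => i _; rewrite /= size_nseq.
Qed.

Lemma subseq_nseq_cat (T : eqType) n (i : T) s t : subseq s (nseq n i ++ t) ->
  exists c s', s = nseq c i ++ s' /\ subseq s' t.
Proof.
elim: n s => [|n IH] s /=; first by move=> st; exists 0%N, s.
case: s => [|j s]; first by move=> _; exists 0%N, [::]; rewrite sub0seq.
case: eqP => [->|_] /IH[c [s' [-> s't]]]; first by exists c.+1, s'.
by exists c, s'.
Qed.

Lemma subseq_flatten_nseq (T : eqType) (a : T -> nat) (e s : seq T) : uniq e ->
  subseq s (flatten [seq nseq (a i) i | i <- e]) ->
  exists b, s = flatten [seq nseq (b i) i | i <- e].
Proof.
elim: e s => [|i e IH] s /=; first by move=> _ /eqP->; exists a.
move=> /andP[ie ue] /subseq_nseq_cat[c [s' [-> /(IH _ ue)[b ->]]]].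
exists (fun j => if j == i then c else b j); rewrite eqxx; congr (_ ++ flatten _).
by apply/eq_in_map => j je; case: eqP => // ji; rewrite -ji je in ie.
Qed.

(** [Cnorm] controls only derivatives taken in the order of [enum 'I_d]. The Leibniz rule
    differentiates along subsequences of such sequences, which are again ordered, so symmetry of
    mixed derivatives is never invoked. *)
Lemma subseq_multi_seq a s : subseq s (multi_seq a) -> exists b, s = multi_seq b.
Proof. by apply: subseq_flatten_nseq; exact: enum_uniq. Qed.

Lemma Cm_Dseq_bounded m v s : Cm m O v -> (size s <= m)%N ->
  exists M, forall x, O x -> `|Dseq s v x| <= M.
Proof.
move=> [_ [_ ev]] sm; have [_ [g [cg gE]]] := ev s sm.
have [M HM] := continuous_closure_bounded bO cg.
by exists M => x Ox; rewrite -gE//; apply: HM; exact: subset_closure.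
Qed.

Lemma supnorm_on_ge (T : Type) (A : set T) (g : T -> R) M x : A x ->
  (forall x, A x -> `|g x| <= M) -> `|g x| <= supnorm_on A g.
Proof.
move=> Ax HM; apply: ub_le_sup; last by exists x.
by exists M => _ [y Ay <-]; exact: HM.
Qed.

Lemma supnorm_on_le (T : Type) (A : set T) (g : T -> R) M : A !=set0 ->
  (forall x, A x -> `|g x| <= M) -> supnorm_on A g <= M.
Proof.
move=> [x Ax] HM; apply: ge_sup; first by exists `|g x|, x.
by move=> _ [y Ay <-]; exact: HM.
Qed.

Lemma supnorm_on_ge0 (T : Type) (A : set T) (g : T -> R) :
  0 <= supnorm_on A g.
Proof.
rewrite /supnorm_on; set E := [set _ | _ in _].
(* Without a supremum, [sup] takes the default value 0. *)
have [|/sup_out->//] := pselect (has_sup E).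
move=> [[r Er] ubE]; apply: le_trans (ub_le_sup ubE Er).
by case: Er => y _ <-.
Qed.

(** An upper bound for alpha! when |alpha| <= m; it undoes the weight 1/alpha! in [Cnorm]. *)
Definition alpha_const (m : nat) : R := ((m`!) ^ d)%:R.

Lemma Cnorm_ge0 m v : 0 <= Cnorm m O v.
Proof.
apply: sumr_ge0 => a _; apply: mulr_ge0; last exact: supnorm_on_ge0.
by rewrite invr_ge0 prodr_ge0.
Qed.

Lemma Dalpha_le_Cnorm m v a x : Cm m O v -> (size (multi_seq a) <= m)%N -> O x ->
  `|Dseq (multi_seq a) v x| <= alpha_const m * Cnorm m O v.
Proof.
move=> cv am Ox.
have am' : (\sum_(i < d) a i <= m)%N by rewrite -size_multi_seq.
have ai i : (a i < m.+1)%N.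
  by rewrite ltnS (leq_trans _ am')// (bigD1 i)//= leq_addr.
pose b : {ffun 'I_d -> 'I_m.+1} := [ffun i => inord (a i)].
have ba i : b i = a i :> nat by rewrite ffunE inordK.
have Db : Dalpha (fun i => b i : nat) v = Dseq (multi_seq a) v.
  rewrite /Dalpha /multi_seq; congr (Dseq (flatten _) _).
  by apply: eq_map => i; rewrite ba.
have P0 : 0 < \prod_(i < d) ((b i : nat)`!)%:R :> R.
  by apply: prodr_gt0 => i _; rewrite ltr0n fact_gt0.
have [M HM] := Cm_Dseq_bounded cv am.
have : (\prod_(i < d) ((b i : nat)`!)%:R)^-1 * `|Dseq (multi_seq a) v x| <= Cnorm m O v.
  rewrite /Cnorm (bigD1 b)/=; last by under eq_bigr do rewrite ba.
  rewrite Db -[leLHS]addr0; apply: lerD.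
    apply: ler_wpM2l; first by rewrite invr_ge0 ltW.
    exact: supnorm_on_ge HM.
  apply: sumr_ge0 => c _; apply: mulr_ge0; last exact: supnorm_on_ge0.
  by rewrite invr_ge0 prodr_ge0.
rewrite mulrC ler_pdivrMr// => /le_trans; apply; rewrite mulrC.
apply: ler_wpM2r; first exact: Cnorm_ge0.
rewrite -natr_prod ler_nat.
have -> : (m`! ^ d = \prod_(i < d) m`!)%N by rewrite prod_nat_const card_ord.
by apply: leq_prod => i _; rewrite leq_fact// -ltnS.
Qed.

Lemma Cnorm_le_card m v M : O !=set0 ->
  (forall a x, (size (multi_seq a) <= m)%N -> O x -> `|Dseq (multi_seq a) v x| <= M) ->
  Cnorm m O v <= #|{ffun 'I_d -> 'I_m.+1}|%:R * M.
Proof.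
move=> O0 HM; have [x Ox] := O0.
have M0 : 0 <= M.
  apply: le_trans (HM (fun=> 0%N) x _ Ox) => //.
  by rewrite size_multi_seq big1.
apply: (@le_trans _ _ (\sum_(a : {ffun 'I_d -> 'I_m.+1} | (\sum_(i < d) (a i : nat) <= m)%N) M)).
  apply: ler_sum => a am.
  apply: (@le_trans _ _ (1 * supnorm_on O (Dalpha (fun i => (a i : nat)) v))).
    apply: ler_wpM2r; first exact: supnorm_on_ge0.
    have P1 : 1 <= \prod_(i < d) ((a i : nat)`!)%:R :> R.
      by rewrite -natr_prod ler1n prodn_gt0// => i; rewrite fact_gt0.
    by rewrite invf_le1// (lt_le_trans ltr01 P1).
  by rewrite mul1r; apply: supnorm_on_le => // y Oy; apply: HM; rewrite ?size_multi_seq.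
by rewrite sumr_const [leRHS]mulr_natl ler_wpMn2l// max_card.
Qed.

(** Each derivative goes to one of the two factors; repeated pairs stand in for the binomial
    coefficients. *)
Fixpoint splits (s : seq 'I_d) : seq (seq 'I_d * seq 'I_d) :=
  if s is i :: s' then
    [seq (i :: p.1, p.2) | p <- splits s'] ++ [seq (p.1, i :: p.2) | p <- splits s']
  else [:: ([::], [::])].

Lemma size_splits s : size (splits s) = (2 ^ size s)%N.
Proof.
by elim: s => //= i s IH; rewrite size_cat !size_map IH addnn -mul2n expnS.
Qed.

Lemma splits_subseq s p : p \in splits s -> subseq p.1 s /\ subseq p.2 s.
Proof.
elim: s p => [|i s IH] p /=; first by rewrite inE => /eqP->.
rewrite mem_cat => /orP[] /mapP[[p1 p2] /IH[s1 s2] ->].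
  by split; [rewrite /= eqxx|exact: subseq_trans s2 (subseq_cons s i)].
by split; [exact: subseq_trans s1 (subseq_cons s i)|rewrite /= eqxx].
Qed.

Lemma is_derive_bigsum (I : eqType) (r : seq I) (F : I -> 'rV[R]_d -> R) (dF : I -> R) x v :
  (forall i, i \in r -> is_derive x v (F i) (dF i)) ->
  is_derive x v (fun x => \sum_(i <- r) F i x) (\sum_(i <- r) dF i).
Proof.
elim: r => [_|i r IH H].
  rewrite big_nil (_ : (fun _ => _) = cst 0); first exact: is_derive_cst.
  by apply/funext => z; rewrite big_nil.
rewrite big_cons (_ : (fun _ => _) = F i + (fun x => \sum_(j <- r) F j x)).
  have Hi := H i (mem_head _ _).
  have Hr := IH (fun j jr => H j (mem_behead (s := i :: r) jr)).
  exact: is_deriveD.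
by apply/funext => z; rewrite big_cons.
Qed.

Lemma Cm_is_derive m v s i x : Cm m O v -> (size s < m)%N -> O x ->
  is_derive x (unitvec R i) (Dseq s v) (Dseq (i :: s) v x).
Proof. by move=> [_ [dv _]] sm Ox; split => //; exact: dv. Qed.

Lemma leibniz_is_derive m f g s i x : Cm m O f -> Cm m O g -> (size s < m)%N -> O x ->
  is_derive x (unitvec R i)
    (fun x => \sum_(p <- splits s) Dseq p.1 f x * Dseq p.2 g x)
    (\sum_(p <- splits (i :: s)) Dseq p.1 f x * Dseq p.2 g x).
Proof.
move=> cf cg sm Ox; rewrite /= big_cat !big_map /= -big_split /=.
apply: is_derive_bigsum => p /splits_subseq[/size_subseq p1 /size_subseq p2].
have h1 := Cm_is_derive i cf (leq_ltn_trans p1 sm) Ox.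
have h2 := Cm_is_derive i cg (leq_ltn_trans p2 sm) Ox.
apply: is_derive_eq (is_deriveM h1 h2) _.
by rewrite addrC; congr (_ + _); exact: mulrC.
Qed.

Lemma leibniz m f g s x : Cm m O f -> Cm m O g -> (size s <= m)%N -> O x ->
  Dseq s (fun y => f y * g y) x = \sum_(p <- splits s) Dseq p.1 f x * Dseq p.2 g x.
Proof.
move=> cf cg; elim: s x => [|i s IH] x sm Ox.
  by rewrite /= big_seq1.
have [_ <-] := leibniz_is_derive i cf cg sm Ox.
rewrite /= /pderiv; apply: near_eq_derive.
have [r r0 rP] := open_normP oO Ox.
apply/nbhs_ballP; exists r => //= z; rewrite -ball_normE /= distrC => zz.
by apply: IH; [exact: ltnW|exact: rP].
Qed.

Lemma Cm_mul m f g : Cm m O f -> Cm m O g -> Cm m O (fun y => f y * g y).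
Proof.
move=> cf cg.
have nearD s z : (size s <= m)%N -> O z -> \forall z' \near z,
    \sum_(p <- splits s) Dseq p.1 f z' * Dseq p.2 g z' = Dseq s (fun y => f y * g y) z'.
  move=> sq Oz; have [r r0 rP] := open_normP oO Oz.
  apply/nbhs_ballP; exists r => //= z'; rewrite -ball_normE /= distrC => zz'.
  by rewrite (leibniz cf cg)//; exact: rP.
split; first by apply: continuous_withinM; [case: cf|case: cg].
split=> [s i z sm Oz|s sm].
  apply: near_eq_derivable (nearD s z (ltnW sm) Oz) _.
  by have [] := leibniz_is_derive i cf cg sm Oz.
(* The extension of a derivative of the product is the Leibniz sum of the extensions for the
   factors. *)
have [h [ch hE]] : exists h : 'rV[R]_d -> R, {within closure O, continuous h} /\
    forall x, O x -> h x = \sum_(p <- splits s) Dseq p.1 f x * Dseq p.2 g x.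
  have : {in splits s, forall p, (size p.1 <= m)%N /\ (size p.2 <= m)%N}.
    move=> p /splits_subseq[/size_subseq p1 /size_subseq p2].
    by split; exact: leq_trans sm.
  elim: (splits s) => [_|p r IH H].
    exists (fun=> 0); split; first by move=> x; exact: cst_continuous.
    by move=> x _; rewrite big_nil.
  have [q qr|h [ch hE]] := IH; first by apply: H; rewrite inE qr orbT.
  have [p1 p2] := H p (mem_head _ _).
  have [_ [_ ef]] := cf; have [_ [_ eg]] := cg.
  have [_ [f1 [cf1 f1E]]] := ef _ p1; have [_ [g1 [cg1 g1E]]] := eg _ p2.
  exists (fun x => f1 x * g1 x + h x); split.
    by apply: continuous_withinD => //; exact: continuous_withinM.
  by move=> x Ox; rewrite big_cons hE// f1E// g1E.
have hD x : O x -> h x = Dseq s (fun y => f y * g y) x.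
  by move=> Ox; rewrite hE// (leibniz cf cg).
split; last by exists h.
move=> z Oz; have := continuous_within_open oO ch Oz.
rewrite /prop_for /continuous_at hD//.
apply: cvg_trans; apply: (@near_eq_cvg _ _ (nbhs z)).
have [r r0 rP] := open_normP oO Oz.
apply/nbhs_ballP; exists r => //= z'; rewrite -ball_normE /= distrC => zz'.
by apply: hD; exact: rP.
Qed.

Lemma Cm_le m m' v : (m <= m')%N -> Cm m' O v -> Cm m O v.
Proof.
move=> mm' [cv [dv ev]]; split => //; split => [s i x sm|s sm].
  by apply: dv; exact: leq_trans mm'.
by apply: ev; exact: leq_trans mm'.
Qed.

Lemma Cnorm_le_Cnorm m m' : (m <= m')%N -> O !=set0 ->
  exists2 C, 0 < C & forall v, Cm m' O v -> Cnorm m O v <= C * Cnorm m' O v.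
Proof.
move=> mm' O0; exists (#|{ffun 'I_d -> 'I_m.+1}|%:R * alpha_const m').
  rewrite mulr_gt0// ltr0n; last by rewrite expn_gt0 fact_gt0.
  by rewrite card_ffun card_ord expn_gt0.
move=> v cv; rewrite -mulrA; apply: Cnorm_le_card => // a x am Ox.
by apply: Dalpha_le_Cnorm => //; exact: leq_trans mm'.
Qed.

Lemma Cnorm_mul_le m m' : (m <= m')%N -> O !=set0 ->
  exists2 C, 0 < C & forall f g, Cm m' O f -> Cm m' O g ->
    Cnorm m O (fun y => f y * g y) <= C * (Cnorm m' O f * Cnorm m' O g).
Proof.
move=> mm' O0.
(* A bound on the number of multi-indices, times at most 2^m Leibniz terms, times one [alpha_const]
   for each factor. *)
exists (#|{ffun 'I_d -> 'I_m.+1}|%:R * ((2 ^ m)%:R * alpha_const m' ^+ 2)).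
  rewrite !mulr_gt0 ?exprn_gt0 ?ltr0n ?expn_gt0 ?fact_gt0//.
  by rewrite card_ffun card_ord expn_gt0.
move=> f g cf cg; rewrite -mulrA; apply: Cnorm_le_card => // a x am Ox.
have sm' := leq_trans am mm'.
rewrite (leibniz cf cg)// (le_trans (ler_norm_sum _ _ _))//.
apply: (@le_trans _ _ (\sum_(p <- splits (multi_seq a))
    (alpha_const m' ^+ 2 * (Cnorm m' O f * Cnorm m' O g)))).
  rewrite big_seq [leRHS]big_seq; apply: ler_sum => p /splits_subseq[p1 p2].
  have s1 := leq_trans (size_subseq p1) sm'.
  have s2 := leq_trans (size_subseq p2) sm'.
  have [b1 e1] := subseq_multi_seq p1; have [b2 e2] := subseq_multi_seq p2.
  rewrite expr2 mulrACA normrM e1 e2; apply: ler_pM => //;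
    by apply: Dalpha_le_Cnorm => //; rewrite -?e1 -?e2.
rewrite big_const_seq count_predT size_splits iter_addr_0.
rewrite -[leRHS]mulrA [leRHS]mulr_natl ler_wpMn2l//; last by rewrite leq_exp2l.
by rewrite !mulr_ge0 ?Cnorm_ge0// sqr_ge0.
Qed.

End Leibniz.

(** * Limits of functionals along an ultrafilter and the compactness argument *)

Section Stability.
Variable R : realType.

(** One r serves all positive exponents, because h <= 1 gives h^n <= h. *)
Lemma mul_exprn_small (D e : R) : 0 < e -> exists2 r : R, 0 < r &
  forall (h : R) (n : nat), 0 < h < r -> (0 < n)%N -> D * h ^+ n <= e.
Proof.
move=> e0; have D0 : 0 < `|D| + 1 by rewrite ltr_wpDl.
exists (Num.min 1 (e / (`|D| + 1))); first by rewrite lt_min ltr01 divr_gt0.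
move=> h n /andP[h0]; rewrite lt_min => /andP[h1 he] n0.
apply: (@le_trans _ _ (`|D| * h)).
  apply: (@le_trans _ _ (`|D| * h ^+ n)).
    by apply: ler_wpM2r; [rewrite exprn_ge0 ?ltW|exact: ler_norm].
  by apply: ler_wpM2l => //; apply: ler_iXnr => //; exact: ltW.
move: he; rewrite ltr_pdivlMr// mulrC mulrDl mul1r => he.
by apply: le_trans (ltW he); rewrite lerDl ltW.
Qed.

Lemma ultra_bounded_cvg (T : Type) (U : set_system T) (a : T -> R) (C : R) :
  UltraFilter U -> (forall n, `|a n| <= C) -> cvg (a n @[n --> U]).
Proof.
move=> UU aC; have PU : ProperFilter U by exact: ultra_proper.
have Ua : UltraFilter (a n @[n --> U]).
  split=> [|G PG UG]; first exact: fmap_proper_filter.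
  rewrite eqEsubset; split => // A GA.
  have [//|UcA] := in_ultra_setVsetC (a @^-1` A) UU.
  have GcA : G (~` A) by exact: UG.
  by exfalso; apply: (@filter_not_empty _ G); rewrite -(setICr A); exact: filterI.
have := @segment_compact R (- C) C; rewrite compact_ultra => /(_ _ Ua)[].
  by apply: nearW => n /=; rewrite in_itv /= -ler_norml.
by move=> l [_ al]; apply/cvg_ex; exists l.
Qed.

Variables (d : nat) (O : set 'rV[R]_d).

(** A form of Banach-Alaoglu: a bounded real family converges along an ultrafilter, hence [L n phi]
    converges for all bounded [phi] simultaneously, with no subsequence to extract. *)
Lemma ultra_lim_functional (T : Type) (U : set_system T) (B : R)
    (L : T -> ('rV[R]_d -> R) -> R) :
  UltraFilter U -> (forall n, bounded_functional O B (L n)) ->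
  exists2 L', bounded_functional O B L' & forall phi, bounded_on_closure O phi ->
    L n phi @[n --> U] --> L' phi.
Proof.
move=> UU bL; have PU : ProperFilter U by exact: ultra_proper.
have cvL phi : bounded_on_closure O phi ->
    L n phi @[n --> U] --> lim (L n phi @[n --> U]).
  move=> [M HM]; apply: (@ultra_bounded_cvg _ _ _ (B * M)) => // n.
  by have [_] := bL n; apply.
exists (fun phi => lim (L n phi @[n --> U])) => //; split.
  move=> a phi psi bphi bpsi; apply: cvg_lim => //.
  rewrite (_ : (fun n => _) = (fun n => a * L n phi + L n psi)).
    by apply: cvgD; [apply: cvgMr|]; exact: cvL.
  by apply/funext => n; have [linL _] := bL n; rewrite linL.
move=> phi M HM; apply/ler_addgt0Pr => e e0.
have bphi : bounded_on_closure O phi by exists M.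
have /cvgrPdist_lt/(_ e e0) /filter_ex[n nP] := cvL _ bphi.
rewrite -(subrK (L n phi) (lim _)) addrC (le_trans (ler_normD _ _))// lerD//.
  by have [_] := bL n; apply.
exact: ltW.
Qed.

Hypotheses (bO : bounded_set O) (oO : open O).

(** The functions z |-> [L n (k z)] are equicontinuous, with a modulus depending on B and [k] only,
    so pointwise convergence is uniform on the compact closure (three terms of size e / 3). *)
Lemma functional_kernel_unif_cvg (T : Type) (U : set_system T) (B : R)
    (L : T -> ('rV[R]_d -> R) -> R) L' k (e : R) :
  Filter U -> (forall n, bounded_functional O B (L n)) ->
  bounded_functional O B L' ->
  (forall phi, bounded_on_closure O phi -> L n phi @[n --> U] --> L' phi) ->
  jointly_continuous O k -> 0 < e ->
  \forall n \near U, forall z, closure O z -> `|L n (k z) - L' (k z)| <= e.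
Proof.
move=> FU bL bL' LL' jk e0.
have := @compact_closure_rV R d O bO.
move=> /compact_near_coveringP/near_covering_withinP cov.
suff : \forall n \near U, closure O `<=` (fun z => `|L n (k z) - L' (k z)| <= e).
  by apply: filterS => n H z /H.
apply: cov => z clz.
have e'0 : 0 < e / 3 / (`|B| + 1) by rewrite !divr_gt0// ltr_wpDl.
have [r r0 rP] := jointly_continuous_unif bO jk clz e'0.
have bk z' : closure O z' -> bounded_on_closure O (k z').
  by move=> clz'; exact: jointly_continuous_bounded_row.
have e30 : 0 < e / 3 by rewrite divr_gt0.
have /cvgrPdist_lt/(_ _ e30) Hn := LL' _ (bk z clz).
have Be : B * (e / 3 / (`|B| + 1)) <= e / 3.
  rewrite mulrCA ger_pMr// ler_pdivrMr ?mul1r; last by rewrite ltr_wpDl.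
  by rewrite (le_trans (ler_norm _))// lerDl.
exists (ball z r, [set n | `|L' (k z) - L n (k z)| < e / 3]) => /=.
  by split => //; exact: nbhsx_ballx.
move=> [z' n] /= [zz' nP] clz'.
have zz'r : `|z' - z| < r by move: zz'; rewrite -ball_normE /= distrC.
have h1 := le_trans (bounded_functional_dist (bL n) (bk _ clz') (bk _ clz) (rP _ clz' zz'r)) Be.
have h2 := le_trans (bounded_functional_dist bL' (bk _ clz') (bk _ clz) (rP _ clz' zz'r)) Be.
rewrite (_ : _ - _ = (L n (k z') - L n (k z)) - (L' (k z) - L n (k z)) -
  (L' (k z') - L' (k z))); last by ring.
rewrite (le_trans (ler_normB _ _))// (le_trans (lerD (ler_normB _ _) (lexx _)))//.
by move: h1 h2 nP; set a := `|_|; set b := `|_|; set c := `|_|; lra.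
Qed.

Variables (q qw : nat) (CQ : R).
Hypothesis qwq : (qw <= q)%N.
Hypothesis int_over_dist : forall v1 v2 M, Cm qw O v1 -> Cm qw O v2 ->
  (forall y, closure O y -> `|v1 y - v2 y| <= M) ->
  `|int_over O v1 - int_over O v2| <= CQ * M.

(** The point is that [eps] depends on B but not on [L]: counterexamples for eps = 1/(n+1) have a
    limit functional, to which the spectral assumption applies. *)
Lemma kernel_stability (B lam : R) k G (eta : R) :
  kernel_derivatives q O k G -> (forall z, closure O z -> Cm q O (k z)) ->
  not_in_spectrum O k lam -> int_over O (fun=> 0) = 0 -> 0 < eta ->
  exists2 eps : R, 0 < eps & forall L, bounded_functional O B L ->
    (forall z, closure O z ->
       `|lam * L (k z) - intop O k (fun z => L (k z)) z| <= eps) ->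
    forall z, closure O z -> `|L (k z)| <= eta.
Proof.
move=> kG ck spec int0 eta0; apply: contrapT => noeps.
have /choice[L HL] : forall n : nat, exists L, [/\ bounded_functional O B L,
    forall z, closure O z ->
       `|lam * L (k z) - intop O k (fun z => L (k z)) z| <= n.+1%:R^-1 &
    exists2 z, closure O z & eta < `|L (k z)|].
  move=> n; apply: contrapT => H; apply: noeps.
  exists n.+1%:R^-1; first by rewrite invr_gt0.
  move=> L bL small z clz; rewrite leNgt; apply/negP => etaL.
  by apply: H; exists L; split => //; exists z.
have bL n : bounded_functional O B (L n) by have [] := HL n.
(* [U] refines [\oo], so 1/(n+1) tends to 0 along it. *)
have [U [UU ooU]] := @ultraFilterLemma nat \oo _.
have PU : ProperFilter U by exact: ultra_proper.
have [L' bL' LL'] := ultra_lim_functional UU bL.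
have [G0 jG _] := kG.
have jk : jointly_continuous O k by rewrite -G0; exact: jG.
have unif e (e0 : 0 < e) : U [set n | forall z, closure O z -> `|L n (k z) - L' (k z)| <= e].
  exact: functional_kernel_unif_cvg bL bL' LL' jk e0.
have [M HM] := jointly_continuous_bounded bO jk.
have cg := functional_kernel_Cm bO oO bL' kG.
have eqn z : closure O z ->
    lam * L' (k z) - intop O k (fun z => L' (k z)) z = 0.
  move=> clz; apply/eqP; rewrite -normr_le0; apply/ler_addgt0Pr => e e0.
  rewrite add0r.
  (* The three summands pay for replacing [L'] by [L n] in the term with [lam], for the residual of
     [L n], and for the same replacement under the integral. *)
  have D0 : 0 < `|lam| + 1 + `|CQ * M| by rewrite ltr_wpDr// ltr_wpDl.
  have e'0 : 0 < e / (`|lam| + 1 + `|CQ * M|) by rewrite divr_gt0.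
  have [n [close small]] : exists n,
      (forall z, closure O z -> `|L n (k z) - L' (k z)| <= e / (`|lam| + 1 + `|CQ * M|)) /\
      n.+1%:R^-1 <= e / (`|lam| + 1 + `|CQ * M|).
    have H2 : \forall n \near U, n.+1%:R^-1 <= e / (`|lam| + 1 + `|CQ * M|).
      by apply: ooU; near=> n; apply: ltW; near: n; exact: near_infty_natSinv_lt (PosNum e'0).
    by have [n [? ?]] := @filter_ex _ U PU _ (filterI (unif _ e'0) H2); exists n.
  have [_ HLn _] := HL n.
  set e' := e / _ in e'0 close small.
  have h2 : `|intop O k (fun z => L n (k z)) z - intop O k (fun z => L' (k z)) z| <= CQ * (M * e').
    apply: int_over_dist.
    - by apply: Cm_le qwq _; apply: Cm_mul => //; [exact: ck|exact: functional_kernel_Cm (bL n) kG].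
    - by apply: Cm_le qwq _; apply: Cm_mul => //; exact: ck.
    move=> y cly; rewrite -mulrBr normrM; apply: ler_pM => //; first exact: HM.
    exact: close.
  have h1 : `|lam * (L' (k z) - L n (k z))| <= `|lam| * e'.
    by rewrite normrM ler_wpM2l// distrC; exact: close.
  have h3 := le_trans (HLn z clz) small.
  have h4 : CQ * (M * e') <= `|CQ * M| * e'.
    by rewrite mulrA; apply: ler_wpM2r; [exact: ltW|exact: ler_norm].
  rewrite (_ : _ - _ = lam * (L' (k z) - L n (k z)) +
    (lam * L n (k z) - intop O k (fun z => L n (k z)) z) +
    (intop O k (fun z => L n (k z)) z - intop O k (fun z => L' (k z)) z)); last by ring.
  rewrite (le_trans (ler_normD _ _))// (le_trans (lerD (ler_normD _ _) (lexx _)))//.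
  have -> : e = `|lam| * e' + 1 * e' + `|CQ * M| * e'.
    by rewrite -!mulrDl mulrC /e' divfK// gt_eqF.
  rewrite mul1r; apply: lerD; first exact: lerD.
  exact: le_trans h4.
have c0 : {within closure O, continuous (fun=> 0 : R)}.
  by move=> x; exact: cst_continuous.
have [v [_ _ uniq]] := spec (fun=> 0) c0.
(* Both z |-> [L' (k z)] and 0 solve the homogeneous equation, so both equal its unique solution
   [v]. *)
have g0 z : closure O z -> L' (k z) = 0.
  move=> clz; have [cg0 _] := cg.
  rewrite (uniq _ cg0 eqn z clz); apply/esym/uniq => //.
  move=> z' _; rewrite /intop mulr0 sub0r (_ : (fun y => _) = fun=> 0) ?int0 ?oppr0//.
  by apply/funext => y; rewrite mulr0.
have [n nP] := @filter_ex _ U PU _ (unif _ eta0).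
have [_ _ [z clz]] := HL n.
by have := nP z clz; rewrite g0// subr0 leNgt => /negP.
Unshelve. all: by end_near. Qed.

End Stability.

(** * The row-sum norm and inverses of matrices bounded below *)

Section RowSumNorm.
Variable R : realType.

Lemma mxnorm_inf_ge0 m n (A : 'M[R]_(m, n)) : 0 <= mxnorm_inf A.
Proof. by rewrite /mxnorm_inf; apply/bigmax_geP; left. Qed.

Lemma mxnorm_inf_le m n (A : 'M[R]_(m, n)) M : 0 <= M ->
  (forall i, \sum_(j < n) `|A i j| <= M) -> mxnorm_inf A <= M.
Proof. by move=> M0 H; apply/bigmax_leP; split. Qed.

Lemma mxnorm_inf_ge_row m n (A : 'M[R]_(m, n)) i :
  \sum_(j < n) `|A i j| <= mxnorm_inf A.
Proof. by apply/bigmax_geP; right; exists i. Qed.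

Lemma mxnorm_inf_colP n (v : 'cV[R]_n) M : 0 <= M ->
  mxnorm_inf v <= M <-> forall j, `|v j 0| <= M.
Proof.
move=> M0; split=> [H j|H].
  by apply: le_trans H; have := mxnorm_inf_ge_row v j; rewrite big_ord1.
by apply: mxnorm_inf_le => // i; rewrite big_ord1.
Qed.

Lemma mulmx_row_le m n (A : 'M[R]_(m, n)) (v : 'cV[R]_n) M i : 0 <= M ->
  (forall j, `|v j 0| <= M) -> `|\sum_(j < n) A i j * v j 0| <= mxnorm_inf A * M.
Proof.
move=> M0 vM; rewrite (le_trans (ler_norm_sum _ _ _))//.
apply: (@le_trans _ _ (\sum_(j < n) `|A i j| * M)).
  by apply: ler_sum => j _; rewrite normrM ler_wpM2l.
by rewrite -mulr_suml ler_wpM2r// mxnorm_inf_ge_row.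
Qed.

(* The row of largest sum is attained at the vector of its signs. *)
Lemma mxnorm_inf_unit_ball m n (A : 'M[R]_(m, n)) M : 0 <= M ->
  (forall v : 'cV[R]_n, (forall j, `|v j 0| <= 1) -> forall i, `|(A *m v) i 0| <= M) ->
  mxnorm_inf A <= M.
Proof.
move=> M0 H; apply: mxnorm_inf_le => // i.
have := H (\col_j Num.sg (A i j)) _ i.
rewrite mxE; under eq_bigr do rewrite mxE mulrC -normrEsg.
move=> /(_ _)/(le_trans (ler_norm _)); apply => j.
by rewrite mxE normr_sg; case: (_ != 0).
Qed.

(** If m = |v| exceeded r / kappa, then v / m would lie in the unit ball with image at most kappa,
    giving m <= 3/4 m. Any factor below 1 would serve. *)
Lemma mx_lower_bound n (A : 'M[R]_n) (kappa : R) : 0 < kappa ->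
  (forall v : 'cV[R]_n, (forall j, `|v j 0| <= 1) ->
     (forall i, `|(A *m v) i 0| <= kappa) -> forall j, `|v j 0| <= 3 / 4) ->
  forall (v : 'cV[R]_n) r, 0 <= r -> (forall i, `|(A *m v) i 0| <= r) ->
    forall j, `|v j 0| <= r / kappa.
Proof.
move=> k0 H v r r0 Avr; apply/mxnorm_inf_colP; first by rewrite divr_ge0// ltW.
rewrite leNgt; apply/negP => rv; set m := mxnorm_inf v in rv.
have m0 : 0 < m by apply: le_lt_trans rv; rewrite divr_ge0// ltW.
have vm j : `|v j 0| <= m by move: j; apply/mxnorm_inf_colP => //; exact: ltW.
have : m <= 3 / 4 * m.
  apply/mxnorm_inf_colP; first by rewrite mulr_ge0 ?ltW.
  move=> j; rewrite -ler_pdivrMr//.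
  have -> : `|v j 0| / m = `|(m^-1 *: v) j 0|.
    by rewrite mxE normrM gtr0_norm ?invr_gt0// mulrC.
  apply: H => [i|i]; rewrite -?scalemxAr mxE normrM gtr0_norm ?invr_gt0// mulrC.
    by rewrite ler_pdivrMr// mul1r.
  rewrite ler_pdivrMr//; apply: le_trans (Avr i) _.
  by move: rv; rewrite ltr_pdivrMr// mulrC => /ltW.
by move: m0; lra.
Qed.

(** The case r = 0 is injectivity; the transpose adapts it to row vectors. *)
Lemma unitmx_lower_bound n (A : 'M[R]_n) (kappa : R) :
  (forall (v : 'cV[R]_n) r, 0 <= r -> (forall i, `|(A *m v) i 0| <= r) ->
    forall j, `|v j 0| <= r / kappa) -> A \in unitmx.
Proof.
move=> H; rewrite -unitmx_tr -row_free_unit; apply: inj_row_free => v vA.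
apply/rowP => j; rewrite mxE; apply/eqP; rewrite -normr_le0 -(mul0r kappa^-1).
have := H v^T 0 (lexx _) _ j; rewrite mxE; apply => i.
by rewrite -[A]trmxK -trmx_mul vA !mxE normr0.
Qed.

Lemma mxnorm_inf_invmx_le n (A : 'M[R]_n) (kappa : R) : 0 < kappa ->
  (forall (v : 'cV[R]_n) r, 0 <= r -> (forall i, `|(A *m v) i 0| <= r) ->
    forall j, `|v j 0| <= r / kappa) -> mxnorm_inf (invmx A) <= kappa^-1.
Proof.
move=> k0 H; have uA := unitmx_lower_bound H.
apply: mxnorm_inf_unit_ball => [|v v1 i]; first by rewrite invr_ge0 ltW.
rewrite -[kappa^-1]mul1r; apply: H => // j.
by rewrite mulmxA mulmxV// mul1mx.
Qed.

End RowSumNorm.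

(** * Norm bounds for kernels, the integral seen through quadrature, the discrete operator *)

Section Nystrom.
Variables (R : realType) (d : nat) (O : set 'rV[R]_d).
Hypotheses (bO : bounded_set O) (oO : open O) (O0 : O !=set0).

Lemma closure_bound_ge0 (phi : 'rV[R]_d -> R) (M : R) :
  (forall y, closure O y -> `|phi y| <= M) -> 0 <= M.
Proof.
move=> H; have [x Ox] := O0.
exact: le_trans (normr_ge0 _) (H x (subset_closure Ox)).
Qed.

(** The coefficients [c] are arbitrary because they serve both as a reconstructed vector and as a
    reconstruction error. *)
Lemma weighted_sum_functional n (y : 'I_n -> 'rV[R]_d) (w c : 'I_n -> R) W C :
  (forall i, closure O (y i)) -> \sum_(i < n) `|w i| <= W -> 0 <= C ->
  (forall i, `|c i| <= C) ->
  bounded_functional O (W * C) (fun phi => \sum_(i < n) w i * phi (y i) * c i).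
Proof.
move=> cly wW C0 cC; split=> [a phi psi _ _|phi M HM].
  by rewrite mulr_sumr -big_split /=; apply: eq_bigr => i _; ring.
have M0 := closure_bound_ge0 HM.
rewrite (le_trans (ler_norm_sum _ _ _))//.
apply: (@le_trans _ _ (\sum_(i < n) `|w i| * (M * C))).
  apply: ler_sum => i _; rewrite -mulrA !normrM ler_wpM2l// ler_pM//.
  exact: HM.
rewrite -mulr_suml -mulrA [C * M]mulrC; apply: ler_wpM2r => //.
exact: mulr_ge0.
Qed.

Lemma eval_functional z : closure O z -> bounded_functional O 1 (fun phi => phi z).
Proof. by move=> clz; split => // phi M HM; rewrite mul1r; exact: HM. Qed.

(** Evaluation at z is a bounded functional, also for z on the boundary; it is applied to the kernel
    with its variables exchanged. *)
Lemma kernel_row_Cm q k : Cm_kernel q O k -> forall z, closure O z -> Cm q O (k z).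
Proof.
move=> ck z clz; have [G kG] := kernel_derivatives_right oO ck.
exact: functional_kernel_Cm (eval_functional clz) kG.
Qed.

(** There are finitely many such sequences; a sum of absolute values stands for the maximum of their
    bounds. *)
Lemma seq_exists_bound (P : seq 'I_d -> R -> Prop) m :
  (forall s M M', M <= M' -> P s M -> P s M') ->
  (forall s, (size s <= m)%N -> exists M, P s M) ->
  exists M, forall s, (size s <= m)%N -> P s M.
Proof.
elim: m P => [|m IH] P mono H; have [M0 HM0] := H [::] isT.
  by exists M0 => -[].
have /choice[M HM] : forall i, exists M, forall s, (size s <= m)%N -> P (i :: s) M.
  move=> i; apply: IH => [s M M'|s sm]; first exact: mono.
  exact: (H (i :: s)).
exists (`|M0| + \sum_i `|M i|) => -[|i s] sm.
  apply: mono HM0; rewrite (le_trans (ler_norm _))// lerDl.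
  by apply: sumr_ge0.
apply: mono (HM i s sm); rewrite (le_trans (ler_norm _))//.
rewrite (bigD1 i)//= addrCA lerDl addr_ge0//.
by apply: sumr_ge0.
Qed.

Lemma functional_kernel_Cnorm_bounded B q k G : kernel_derivatives q O k G ->
  exists N, forall L, bounded_functional O B L ->
    Cnorm q O (fun z => L (k z)) <= N.
Proof.
move=> kG; have [_ jG _] := kG.
have [M HM] : exists M, forall s, (size s <= q)%N ->
    forall z y, closure O z -> closure O y -> `|G s z y| <= M.
  apply: (@seq_exists_bound (fun s M => forall z y, closure O z -> closure O y -> `|G s z y| <= M)).
    by move=> s M M' MM' H z y clz cly; rewrite (le_trans (H _ _ clz cly)).
  by move=> s sq; apply: jointly_continuous_bounded => //; exact: jG.
exists (#|{ffun 'I_d -> 'I_q.+1}|%:R * (B * M)) => L bL.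
apply: Cnorm_le_card => // a x am Ox; rewrite (functional_kernel_Dseq bO oO bL kG)//.
have [_] := bL; apply => y cly; apply: HM => //; exact: subset_closure.
Qed.

Lemma Cnorm_le_kCm_sup q k z : Cm_kernel q O k -> closure O z ->
  Cnorm q O (k z) <= kCm_sup q O k.
Proof.
move=> ck clz; have [G kG] := kernel_derivatives_right oO ck.
have [N HN] := functional_kernel_Cnorm_bounded 1 kG.
apply: ub_le_sup; last by exists z.
exists N => _ [z' clz' <-]; exact: HN (eval_functional clz').
Qed.

Lemma norm_le_kC0norm k z y : jointly_continuous O k -> closure O z -> closure O y ->
  `|k z y| <= kC0norm O k.
Proof.
move=> jk clz cly; have [M HM] := jointly_continuous_bounded bO jk.
apply: ub_le_sup; last by exists (z, y).
by exists M => _ [[z' y'] [clz' cly'] <-]; exact: HM.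
Qed.

(** A zero norm would make the zeroth-order term vanish on [O], and on the closure by continuity. *)
Lemma Cnorm_gt0 m v : Cm m O v -> (exists2 z, closure O z & v z != 0) ->
  0 < Cnorm m O v.
Proof.
move=> cv [z clz vz]; rewrite lt_neqAle Cnorm_ge0 andbT; apply/eqP => n0.
move: vz; rewrite -normr_gt0 ltNge => /negP; apply.
have [cv0 _] := cv; apply: closure_norm_le cv0 _ z clz => x Ox.
have E0 : multi_seq (fun=> 0%N : nat) = [::] :> seq 'I_d.
  by apply/nilP; rewrite /nilp size_multi_seq big1.
have := @Dalpha_le_Cnorm R d O bO m v (fun=> 0%N) x cv.
by rewrite E0 -n0 mulr0; apply.
Qed.

Lemma iter_int0 n : @iter_int R n (fun=> 0) = 0.
Proof.
elim: n => // n IH /=; under eq_Rintegral do rewrite IH.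
by rewrite /Rintegral integral0.
Qed.

Lemma int_over0 : int_over O (fun=> 0 : R) = 0.
Proof.
rewrite /int_over (_ : (fun z => _) = fun=> 0) ?iter_int0//.
by apply/funext => z; case: ifP.
Qed.

Section Quadrature.
Variables (nY : R -> nat) (y : forall hY : R, 'I_(nY hY) -> 'rV[R]_d).
Variables (w : forall hY : R, 'I_(nY hY) -> R) (CQ Cw : R) (qw : nat).
Hypotheses (qs : quad_scheme O y w) (qst : quad_stable w CQ) (qw0 : (0 < qw)%N).
Hypothesis (qc : quad_convergent O y w qw Cw).

Lemma int_over_dist v1 v2 M : Cm qw O v1 -> Cm qw O v2 ->
  (forall z, closure O z -> `|v1 z - v2 z| <= M) ->
  `|int_over O v1 - int_over O v2| <= CQ * M.
Proof.
move=> c1 c2 HM; apply/ler_addgt0Pr => e e0.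
(* At the single mesh size r / 2 the two quadrature errors add up to at most e. *)
have [r r0 rP] := @mul_exprn_small R (Cw * (Cnorm qw O v1 + Cnorm qw O v2)) e e0.
have h0 : 0 < r / 2 by lra.
have := rP (r / 2) qw; rewrite h0 /= => /(_ _ qw0) small.
have {small} : Cw * (Cnorm qw O v1 + Cnorm qw O v2) * (r / 2) ^+ qw <= e.
  by apply: small; lra.
have h1 := qc h0 c1; have h2 := qc h0 c2.
have h3 : `|\sum_(i < nY (r / 2)) w i * v1 (y i) -
    \sum_(i < nY (r / 2)) w i * v2 (y i)| <= CQ * M.
  have M0 := closure_bound_ge0 HM.
  rewrite -sumrB (le_trans (ler_norm_sum _ _ _))//.
  apply: (@le_trans _ _ (\sum_(i < nY (r / 2)) `|w i| * M)).
    apply: ler_sum => i _; rewrite -mulrBr normrM ler_wpM2l// HM//.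
    by have [/(_ _ h0)[_]] := qs.
  by rewrite -mulr_suml ler_wpM2r//; exact: qst.
move: h1 h2 h3.
set a := Cw * (r / 2) ^+ qw * _; set b := Cw * (r / 2) ^+ qw * _.
set I1 := int_over O v1; set I2 := int_over O v2; set Q1 := \sum_(i < _) _; set Q2 := \sum_(i < _) _.
move=> h1 h2 h3.
rewrite (_ : Cw * _ * _ = a + b); last by rewrite /a /b; ring.
move=> h4; rewrite (_ : I1 - I2 = (Q1 - Q2) + ((I1 - Q1) - (I2 - Q2))); last by ring.
rewrite (le_trans (ler_normD _ _))// lerD//.
by rewrite (le_trans (ler_normB _ _))// (le_trans _ h4)// lerD.
Qed.

Lemma quad_weight_ge0 : 0 <= CQ.
Proof. by apply: le_trans (qst ltr01); apply: sumr_ge0. Qed.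

(** A nonzero test function at hY = 1 fixes the sign of the constant. *)
Lemma quad_const_ge0 f : Cm qw O f -> (exists2 z, closure O z & f z != 0) -> 0 <= Cw.
Proof.
move=> cf f0; have := le_trans (normr_ge0 _) (qc ltr01 cf).
by rewrite expr1n mulr1 pmulr_lge0//; exact: Cnorm_gt0.
Qed.

(** Used to extend the equation for [u] from [O] to nodes on the boundary. *)
Lemma intop_continuous q k v : (qw <= q)%N -> jointly_continuous O k ->
  (forall z, closure O z -> Cm q O (k z)) -> Cm q O v ->
  {within closure O, continuous (intop O k v)}.
Proof.
move=> qwq jk ck cv; have [cv0 _] := cv.
have [M HM] := continuous_closure_bounded bO cv0.
have M0 := closure_bound_ge0 HM.
apply/continuous_within_normP => z clz e e0.
have D0 : 0 < CQ * M + 1 by rewrite ltr_wpDl// mulr_ge0// quad_weight_ge0.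
have e'0 : 0 < e / (CQ * M + 1) by rewrite divr_gt0.
have [r r0 rP] := jointly_continuous_unif bO jk clz e'0.
exists r => // z' clz' zz'.
apply: (@le_lt_trans _ _ (CQ * (e / (CQ * M + 1) * M))).
  apply: int_over_dist; try by apply: Cm_le qwq _; apply: Cm_mul => //; exact: ck.
  move=> x clx; rewrite -mulrBl normrM ler_pM//; first exact: rP.
  exact: HM.
rewrite mulrCA -mulrA gtr_pMr// mulrC ltr_pdivrMr// mul1r.
by rewrite ltrDl.
Qed.

End Quadrature.

(** The discrete operator K_h applied to [v]: the Nyström interpolant is lam^-1 * (K_h v + f). *)
Definition nystrom_sum nx ny (k : 'rV[R]_d -> 'rV[R]_d -> R)
    (y : 'I_ny -> 'rV[R]_d) (w : 'I_ny -> R) (Rm : 'M[R]_(ny, nx)) (v : 'cV[R]_nx)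
    (z : 'rV[R]_d) : R :=
  \sum_(i < ny) w i * k z (y i) * (\sum_(j < nx) Rm i j * v j 0).

Lemma nystrom_sumD nx ny k (y : 'I_ny -> 'rV[R]_d) w Rm (u v : 'cV[R]_nx) z :
  nystrom_sum k y w Rm (u + v) z = nystrom_sum k y w Rm u z + nystrom_sum k y w Rm v z.
Proof.
rewrite /nystrom_sum -big_split /=; apply: eq_bigr => i _; rewrite -mulrDr.
by congr (_ * _); rewrite -big_split /=; apply: eq_bigr => j _; rewrite mxE mulrDr.
Qed.

Lemma nystrom_sumZ nx ny k (y : 'I_ny -> 'rV[R]_d) w Rm a (v : 'cV[R]_nx) z :
  nystrom_sum k y w Rm (a *: v) z = a * nystrom_sum k y w Rm v z.
Proof.
rewrite /nystrom_sum mulr_sumr; apply: eq_bigr => i _; rewrite mulrCA.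
by congr (_ * _); rewrite mulr_sumr; apply: eq_bigr => j _; rewrite mxE mulrCA.
Qed.

Lemma nystrom_matrixE nx ny k lam (x : 'I_nx -> 'rV[R]_d) (y : 'I_ny -> 'rV[R]_d) w Rm v i :
  (nystrom_matrix k lam x y w Rm *m v) i 0 =
  lam * v i 0 - nystrom_sum k y w Rm v (x i).
Proof.
rewrite /nystrom_matrix mulmxBl mul_scalar_mx mul_mx_diag -mulmxA.
rewrite mxE [X in X + _]mxE [X in _ + X]mxE; congr (_ - _).
rewrite mxE; apply: eq_bigr => j _; rewrite [X in _ * X]mxE 3!mxE.
by rewrite [w j * _]mulrC.
Qed.

Lemma nystrom_sum_le nx ny k (y : 'I_ny -> 'rV[R]_d) w (Rm : 'M[R]_(ny, nx))
    (v : 'cV[R]_nx) z (CQ CI r : R) :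
  jointly_continuous O k -> closure O z -> (forall i, closure O (y i)) ->
  \sum_(i < ny) `|w i| <= CQ -> mxnorm_inf Rm <= CI -> 0 <= r ->
  (forall j, `|v j 0| <= r) ->
  `|nystrom_sum k y w Rm v z| <= CQ * (CI * r) * kC0norm O k.
Proof.
move=> jk clz cly wCQ RCI r0 vr.
have CI0 : 0 <= CI by apply: le_trans RCI; exact: mxnorm_inf_ge0.
have cC i : `|\sum_(j < nx) Rm i j * v j 0| <= CI * r.
  by apply: le_trans (mulmx_row_le Rm i r0 vr) _; exact: ler_wpM2r.
have [_ bL] := weighted_sum_functional cly wCQ (mulr_ge0 CI0 r0) cC.
by apply: bL => t clt; exact: norm_le_kC0norm.
Qed.

End Nystrom.

(** * Consistency of the discrete operator and the uniform lower bound *)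

Section Convergence.
Variables (R : realType) (d : nat) (O : set 'rV[R]_d).
Hypotheses (bO : bounded_set O) (oO : open O) (O0 : O !=set0).
Variables (k : 'rV[R]_d -> 'rV[R]_d -> R) (q : nat).
Hypothesis (ck : Cm_kernel q O k).
Variables (nX nY : R -> nat).
Variables (x : forall hX : R, 'I_(nX hX) -> 'rV[R]_d).
Variables (y : forall hY : R, 'I_(nY hY) -> 'rV[R]_d).
Variables (w : forall hY : R, 'I_(nY hY) -> R).
Variables (Rm : forall hX hY : R, 'M[R]_(nY hY, nX hX)).
Variables (CQ Cw CI CR : R) (qw qR : nat).
Hypotheses (qs : quad_scheme O y w) (qst : quad_stable w CQ).
Hypotheses (qw0 : (0 < qw)%N) (qwq : (qw <= q)%N) (qc : quad_convergent O y w qw Cw).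
Hypotheses (xs : node_set O x) (rst : recon_stable Rm CI).
Hypotheses (qR0 : (0 < qR)%N) (qRq : (qR <= q)%N).
Hypotheses (rc : recon_convergent O x y Rm qR CR).
Hypotheses (Cw0 : 0 <= Cw) (CR0 : 0 <= CR).

Definition nystrom_rate (hX hY : R) : R :=
  Cw * kCm_sup q O k * hY ^+ qw + CQ * CR * kC0norm O k * hX ^+ qR.

Lemma kernel_jointly_continuous : jointly_continuous O k.
Proof.
by have [G [G0 jG _]] := kernel_derivatives_left oO ck; rewrite -G0; exact: jG.
Qed.

Lemma kC0norm_ge0 : 0 <= kC0norm O k.
Proof.
have [z Oz] := O0; have clz := subset_closure Oz.
exact: le_trans (normr_ge0 _) (norm_le_kC0norm bO kernel_jointly_continuous clz clz).
Qed.

Lemma kCm_sup_ge0 : 0 <= kCm_sup q O k.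
Proof.
have [z Oz] := O0; apply: le_trans (Cnorm_ge0 O q (k z)) _.
by apply: Cnorm_le_kCm_sup => //; exact: subset_closure.
Qed.

Lemma nystrom_rate_ge0 hX hY : 0 < hX -> 0 < hY -> 0 <= nystrom_rate hX hY.
Proof.
move=> hX0 hY0; have CQ0 := quad_weight_ge0 qst.
by apply: addr_ge0; rewrite !mulr_ge0 ?exprn_ge0 ?kC0norm_ge0 ?kCm_sup_ge0 ?(ltW hX0) ?(ltW hY0).
Qed.

(** The error is the quadrature error for [k z * g] plus the weighted reconstruction error of [g];
    [C1] comes from the product estimate, [C2] from comparing the C^qR and C^q norms. *)
Lemma nystrom_consistency : exists2 C, 0 < C &
  forall g, Cm q O g -> forall hX hY, 0 < hX -> 0 < hY -> forall z, closure O z ->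
  `|intop O k g z - nystrom_sum k (@y hY) (@w hY) (Rm hX hY) (restr (@x hX) g) z|
    <= C * nystrom_rate hX hY * Cnorm q O g.
Proof.
have [C1 C10 HC1] := Cnorm_mul_le bO oO qwq O0.
have [C2 C20 HC2] := Cnorm_le_Cnorm bO qRq O0.
have CQ0 := quad_weight_ge0 qst.
exists (C1 + C2); first exact: addr_gt0.
move=> g cg hX hY hX0 hY0 z clz.
have ckz := kernel_row_Cm bO oO ck clz.
have cly i : closure O (@y hY i) by have [/(_ _ hY0)[_]] := qs.
have n0 := Cnorm_ge0 O q g.
have h1 : `|intop O k g z - \sum_(i < nY hY) w i * (k z (y i) * g (y i))| <=
    C1 * (Cw * kCm_sup q O k * hY ^+ qw) * Cnorm q O g.
  have ckg : Cm qw O (fun t => k z t * g t) by apply: Cm_le qwq _; exact: Cm_mul.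
  apply: le_trans (qc hY0 ckg) _.
  apply: (@le_trans _ _ (Cw * hY ^+ qw * (C1 * (kCm_sup q O k * Cnorm q O g)))).
    apply: ler_wpM2l; first by rewrite mulr_ge0// exprn_ge0// ltW.
    apply: le_trans (HC1 _ _ ckz cg) _; apply: ler_wpM2l; first exact: ltW.
    by apply: ler_wpM2r => //; exact: Cnorm_le_kCm_sup.
  by rewrite le_eqVlt; apply/orP; left; apply/eqP; ring.
pose dlt := restr (@y hY) g - Rm hX hY *m restr (@x hX) g.
have h2 i : `|dlt i 0| <= CR * hX ^+ qR * (C2 * Cnorm q O g).
  have := rc hX0 hY0 (Cm_le qRq cg); rewrite -/dlt => H.
  have := mxnorm_inf_ge_row dlt i; rewrite big_ord1 => /le_trans; apply.
  apply: le_trans H _; apply: ler_wpM2l; last exact: HC2.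
  by rewrite mulr_ge0// exprn_ge0// ltW.
have h3 : `|\sum_(i < nY hY) w i * (k z (y i) * g (y i)) -
    nystrom_sum k (@y hY) (@w hY) (Rm hX hY) (restr (@x hX) g) z| <=
    C2 * (CQ * CR * kC0norm O k * hX ^+ qR) * Cnorm q O g.
  have E : \sum_(i < nY hY) w i * (k z (y i) * g (y i)) -
      nystrom_sum k (@y hY) (@w hY) (Rm hX hY) (restr (@x hX) g) z =
      \sum_(i < nY hY) w i * k z (y i) * dlt i 0.
    rewrite /nystrom_sum -sumrB; apply: eq_bigr => i _.
    by rewrite mulrA -mulrBr /dlt !mxE.
  rewrite {}E.
  have D0 : 0 <= CR * hX ^+ qR * (C2 * Cnorm q O g).
    by rewrite !mulr_ge0 ?exprn_ge0 ?(ltW hX0) ?(ltW C20).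
  have [_ bL] := weighted_sum_functional O0 cly (qst hY0) D0 h2.
  apply: le_trans (bL _ _ (fun t => norm_le_kC0norm bO kernel_jointly_continuous clz)) _.
  by rewrite le_eqVlt; apply/orP; left; apply/eqP; ring.
rewrite -(subrK (\sum_(i < nY hY) w i * (k z (y i) * g (y i))) (intop O k g z)) -addrA.
rewrite (le_trans (ler_normD _ _))//.
have a0 : 0 <= Cw * kCm_sup q O k * hY ^+ qw * Cnorm q O g.
  by rewrite !mulr_ge0 ?exprn_ge0 ?kCm_sup_ge0 ?(ltW hY0).
have b0 : 0 <= CQ * CR * kC0norm O k * hX ^+ qR * Cnorm q O g.
  by rewrite !mulr_ge0 ?exprn_ge0 ?kC0norm_ge0 ?(ltW hX0).
apply: le_trans (lerD h1 h3) _; rewrite /nystrom_rate.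
set a := Cw * _ * _ in a0 *; set b := CQ * _ * _ * _ in b0 *.
(* What [C1 + C2] gives in excess are the two nonnegative cross terms. *)
rewrite -subr_ge0 (_ : _ - _ = C2 * (a * Cnorm q O g) + C1 * (b * Cnorm q O g)); last by ring.
by rewrite addr_ge0// mulr_ge0// ltW.
Qed.

Lemma nystrom_lower_bound lam : lam != 0 -> not_in_spectrum O k lam ->
  exists2 delta : R, 0 < delta & exists2 kappa : R, 0 < kappa &
    forall hX hY, 0 < hX < delta -> 0 < hY < delta ->
    forall (v : 'cV[R]_(nX hX)) r, 0 <= r ->
      (forall i, `|(nystrom_matrix k lam (@x hX) (@y hY) (@w hY) (Rm hX hY) *m v) i 0| <= r) ->
      forall j, `|v j 0| <= r / kappa.
Proof.
move=> lam0 spec.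
have [G kG] := kernel_derivatives_left oO ck.
have jk := kernel_jointly_continuous.
have CQ0 := quad_weight_ge0 qst.
have CI0 : 0 <= CI by apply: le_trans (rst ltr01 ltr01); exact: mxnorm_inf_ge0.
have l0 : 0 < `|lam| by rewrite normr_gt0.
have eta0 : 0 < `|lam| / 2 by rewrite divr_gt0.
have idist := @int_over_dist R d O O0 _ _ _ _ _ _ qs qst qw0 qc.
have [eps eps0 stab] := kernel_stability bO oO qwq idist (CQ * CI) kG
  (kernel_row_Cm bO oO ck) spec (int_over0 O) eta0.
have [N HN] := functional_kernel_Cnorm_bounded bO oO O0 (CQ * CI) kG.
have [C1 C10 cons] := nystrom_consistency.
(* Quadrature and reconstruction may each use eps / 4; the remaining eps / 2 is for K_h (A v). *)
have e40 : 0 < eps / 4 by rewrite divr_gt0.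
have [r1 r10 r1P] := mul_exprn_small (C1 * (Cw * kCm_sup q O k) * N) e40.
have [r2 r20 r2P] := mul_exprn_small (C1 * (CQ * CR * kC0norm O k) * N) e40.
pose B := CQ * CI * kC0norm O k.
have B0 : 0 <= B by rewrite !mulr_ge0// kC0norm_ge0.
(* The second entry keeps K_h (A v) below eps / 2. The first, with |g| <= |lam| / 2, gives |lam v|
   <= 3/4 |lam|. *)
pose kappa := Num.min (`|lam| / 4) (eps / 2 / (B + 1)).
have kappa0 : 0 < kappa.
  by rewrite lt_min !divr_gt0// ltr_wpDl.
exists (Num.min r1 r2); first by rewrite lt_min r10.
exists kappa => // hX hY /andP[hX0]; rewrite lt_min => /andP[hX1 hX2].
move=> /andP[hY0]; rewrite lt_min => /andP[hY1 hY2].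
apply: mx_lower_bound => // v v1 Av j.
have clyi i : closure O (@y hY i) by have [/(_ _ hY0)[_]] := qs.
have clxj i : closure O (@x hX i) by have [_] := xs hX0.
pose L := fun phi => \sum_(i < nY hY) w i * phi (y i) * (\sum_(j < nX hX) Rm hX hY i j * v j 0).
have bL : bounded_functional O (CQ * CI) L.
  apply: weighted_sum_functional => //; first exact: qst.
  move=> i; apply: le_trans (mulmx_row_le (Rm hX hY) i ler01 v1) _.
  by rewrite mulr1; exact: rst.
pose g z := L (k z).
have cg : Cm q O g := functional_kernel_Cm bO oO bL kG.
have gE z : g z = nystrom_sum k (@y hY) (@w hY) (Rm hX hY) v z by [].
(* Applying K_h, with g = K_h v, gives lam g - K g = (K_h g - K g) + K_h (A v): a consistency error
   plus a term controlled by |A v|. *)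
have lamv : lam *: v = restr (@x hX) g +
    nystrom_matrix k lam (@x hX) (@y hY) (@w hY) (Rm hX hY) *m v.
  apply/matrixP => i c; rewrite (ord1 c) [in RHS]mxE nystrom_matrixE mxE [in RHS]mxE gE.
  by ring.
have small z : closure O z -> `|lam * L (k z) - intop O k (fun z => L (k z)) z| <= eps.
  move=> clz; rewrite -/(g z) gE -nystrom_sumZ lamv nystrom_sumD.
  have h1 := cons g cg hX hY hX0 hY0 z clz.
  have h2 := nystrom_sum_le bO O0 jk clz clyi (qst hY0) (rst hX0 hY0) (ltW kappa0) Av.
  rewrite addrAC (le_trans (ler_normD _ _))// distrC.
  have h3 : CQ * (CI * kappa) * kC0norm O k <= eps / 2.
    rewrite (_ : CQ * _ * _ = B * kappa); last by rewrite /B; ring.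
    apply: (@le_trans _ _ (B * (eps / 2 / (B + 1)))).
      by apply: ler_wpM2l => //; rewrite ge_min lexx orbT.
    rewrite mulrCA ger_pMr ?divr_gt0// ler_pdivrMr ?mul1r ?lerDl//.
    by rewrite ltr_wpDl.
  have h4 : C1 * nystrom_rate hX hY * Cnorm q O g <= eps / 2.
    apply: (@le_trans _ _ (C1 * nystrom_rate hX hY * N)).
      apply: ler_wpM2l; last exact: HN.
      by rewrite mulr_ge0 ?nystrom_rate_ge0// ltW.
    have k1 : C1 * (Cw * kCm_sup q O k) * N * hY ^+ qw <= eps / 4.
      by apply: r1P => //; rewrite hY0.
    have k2 : C1 * (CQ * CR * kC0norm O k) * N * hX ^+ qR <= eps / 4.
      by apply: r2P => //; rewrite hX0.
    apply: le_trans (_ : _ <= eps / 4 + eps / 4) _; last by lra.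
    apply: le_trans (lerD k1 k2); rewrite le_eqVlt; apply/orP; left; apply/eqP.
    by rewrite /nystrom_rate; ring.
  have := lerD (le_trans h1 h4) (le_trans h2 h3).
  by rewrite -splitr; apply: le_trans; rewrite lexx.
have gs := stab L bL small (x j) (clxj j).
have : `|lam * v j 0| <= `|lam| / 2 + `|lam| / 4.
  have -> : lam * v j 0 = g (x j) +
      (nystrom_matrix k lam (@x hX) (@y hY) (@w hY) (Rm hX hY) *m v) j 0.
    by have := congr1 (fun M : 'cV_ _ => M j 0) lamv; rewrite !mxE.
  rewrite (le_trans (ler_normD _ _))// lerD//.
  by apply: le_trans (Av j) _; rewrite ge_min lexx.
rewrite normrM => H; rewrite -(ler_pM2l l0); apply: le_trans H _.
by lra.
Qed.

End Convergence.

(** * Solvability, conditioning and the error estimate *)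

Theorem theorem3p10 (R : realType) (d : nat) (O : set 'rV[R]_d) (q : nat) (lam : R)
  (k : 'rV[R]_d -> 'rV[R]_d -> R) (f u : 'rV[R]_d -> R)
  (nX nY : R -> nat)
  (x : forall hX : R, 'I_(nX hX) -> 'rV[R]_d)
  (y : forall hY : R, 'I_(nY hY) -> 'rV[R]_d)
  (w : forall hY : R, 'I_(nY hY) -> R)
  (Rm : forall hX hY : R, 'M[R]_(nY hY, nX hX))
  (CQ Cw CR : R) (qw qR : nat) :
  (* Omega bounded open, q >= 1, lambda <> 0 *)
  bounded_set O -> open O -> (1 <= q)%N -> lam != 0 ->
  (* k in C^q(closure Omega x closure Omega), f in C^q(closure Omega), f <> 0 *)
  Cm_kernel q O k -> Cm q O f -> (exists2 z, closure O z & f z != 0) ->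
  (* (1) lambda not in the spectrum of K; u in C^q the solution *)
  not_in_spectrum O k lam ->
  Cm q O u -> (forall z, O z -> lam * u z - intop O k u z = f z) ->
  (* (2) stable, convergent quadrature scheme *)
  quad_scheme O y w -> quad_stable w CQ ->
  (0 < qw)%N -> (qw <= q)%N -> quad_convergent O y w qw Cw ->
  (* (3) stable, convergent reconstruction scheme *)
  node_set O x -> (exists CI : R, recon_stable Rm CI) ->
  (0 < qR)%N -> (qR <= q)%N -> recon_convergent O x y Rm qR CR ->
  exists delta C Kcond : R,
    [/\ 0 < delta, 0 < C &
      forall hX hY : R, 0 < hX < delta -> 0 < hY < delta ->
        let A := nystrom_matrix k lam (x hX) (y hY) (w hY) (Rm hX hY) in
        let fX := restr (x hX) f in
        [/\ exists! uhat : 'cV[R]_(nX hX), A *m uhat = fX,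
            cond_inf A <= Kcond &
            forall uhat : 'cV[R]_(nX hX), A *m uhat = fX ->
              supnorm_on (closure O)
                (fun z => u z - nystrom_interp k f lam (y hY) (w hY) (Rm hX hY) uhat z)
              <= C * (Cw * kCm_sup q O k * hY ^+ qw
                      + CQ * CR * kC0norm O k * hX ^+ qR) * Cnorm q O u]].
Proof.
move=> bO oO q1 lam0 ck cf f0 spec cu ueq qs qst qw0 qwq qc xs [CI rst] qR0 qRq rc.
have [z0 clz0 _] := f0.
have O0 : O !=set0.
  by have /closure_normP/(_ 1 ltr01)[a Oa _] := clz0; exists a.
have Cw0 := quad_const_ge0 bO qc (Cm_le qwq cf) f0.
have CR0 : 0 <= CR.
  have := le_trans (mxnorm_inf_ge0 _) (rc 1 1 ltr01 ltr01 f (Cm_le qRq cf)).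
  rewrite expr1n mulr1 pmulr_lge0//; apply: Cnorm_gt0 => //; exact: Cm_le cf.
have CQ0 := quad_weight_ge0 qst.
have CI0 : 0 <= CI by apply: le_trans (rst 1 1 ltr01 ltr01); exact: mxnorm_inf_ge0.
have jk := kernel_jointly_continuous oO ck.
have K0 := kC0norm_ge0 bO oO O0 ck.
have l0 : 0 < `|lam| by rewrite normr_gt0.
have [C1 C10 cons] := nystrom_consistency bO oO O0 ck qs qst qwq qc qRq rc Cw0 CR0.
have [delta delta0 [kappa kappa0 lower]] :=
  nystrom_lower_bound bO oO O0 ck qs qst qw0 qwq qc xs rst qR0 qRq rc Cw0 CR0 lam0 spec.
(* The equation is given on [O], but solution nodes may lie on the boundary. *)
have ueq' z : closure O z -> f z = lam * u z - intop O k u z.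
  move=> clz; have [cu0 _] := cu; have [cf0 _] := cf.
  have cK := intop_continuous bO oO O0 qs qst qw0 qc qwq jk (kernel_row_Cm bO oO ck) cu.
  apply/esym/eqP; rewrite -subr_eq0 -normr_le0.
  apply: (@closure_norm_le _ _ O (fun z => lam * u z - intop O k u z - f z)) => //.
    apply: continuous_within_eq _ (continuous_withinD (continuous_withinD
      (continuous_withinZ (a := lam) cu0) (continuous_withinZ (a := -1) cK))
      (continuous_withinZ (a := -1) cf0)) => t _.
    by ring.
  by move=> t Ot; rewrite ueq// subrr normr0.
pose B := CQ * CI * kC0norm O k.
have B0 : 0 <= B by rewrite !mulr_ge0.
(* B bounds K_h, so |A| <= |lam| + B, while 1 / kappa bounds the inverse. In the error constant, 1
   accounts for consistency and B / kappa for the error at the nodes. *)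
exists delta, (`|lam|^-1 * (1 + B / kappa) * C1), ((`|lam| + B) * kappa^-1).
split => //.
  by rewrite !mulr_gt0 ?invr_gt0// ltr_wpDr// divr_ge0// ltW.
move=> hX hY hXd hYd A fX.
have {}lower := lower hX hY hXd hYd; rewrite -/A in lower.
have /andP[hX0 _] := hXd; have /andP[hY0 _] := hYd.
have clyi i : closure O (y hY i) by have [/(_ _ hY0)[_]] := qs.
have clxj i : closure O (x hX i) by have [_] := xs _ hX0.
have uA := unitmx_lower_bound lower.
have sum_le (v : 'cV[R]_(nX hX)) z (r : R) : closure O z -> 0 <= r -> (forall j, `|v j 0| <= r) ->
    `|nystrom_sum k (y hY) (w hY) (Rm hX hY) v z| <= B * r.
  move=> clz r0 vr; have := nystrom_sum_le bO O0 jk clz clyi (qst _ hY0) (rst _ _ hX0 hY0) r0 vr.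
  by move=> /le_trans; apply; rewrite le_eqVlt; apply/orP; left; apply/eqP; rewrite /B; ring.
split.
- exists (invmx A *m fX); split; first by rewrite mulmxA mulmxV// mul1mx.
  by move=> v <-; rewrite mulmxA mulVmx// mul1mx.
- apply: ler_pM; rewrite ?mxnorm_inf_ge0//; last exact: mxnorm_inf_invmx_le.
  apply: mxnorm_inf_unit_ball; first by rewrite addr_ge0.
  move=> v v1 i; rewrite nystrom_matrixE (le_trans (ler_normB _ _))// lerD//.
    by rewrite normrM ler_piMr.
  by rewrite -[B]mulr1; exact: sum_le.
move=> uhat Auhat.
set rate := Cw * _ * _ + _.
pose tau := C1 * rate * Cnorm q O u.
have tauP z : closure O z -> `|intop O k u z -
    nystrom_sum k (y hY) (w hY) (Rm hX hY) (restr (x hX) u) z| <= tau.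
  by move=> clz; exact: cons.
have tau0 : 0 <= tau by apply: le_trans (tauP z0 clz0).
pose e := uhat - restr (x hX) u.
(* At the nodes, A e = K_h u - K u, which is the consistency error of [u]. *)
have Ae i : `|(A *m e) i 0| <= tau.
  rewrite /e mulmxBr Auhat mxE [X in _ + X]mxE nystrom_matrixE !mxE ueq'//.
  rewrite -normrN [X in `|X|](_ : _ = intop O k u (x hX i) -
    nystrom_sum k (y hY) (w hY) (Rm hX hY) (restr (x hX) u) (x hX i)); last by ring.
  exact: tauP.
have e_le := lower e tau tau0 Ae.
have uhatE : uhat = restr (x hX) u + e by rewrite /e addrC subrK.
apply: supnorm_on_le => [|z clz]; first by exists z0.
rewrite /nystrom_interp -/(nystrom_sum k (y hY) (w hY) (Rm hX hY) uhat z).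
rewrite uhatE nystrom_sumD ueq'//.
set s1 := nystrom_sum _ _ _ _ _ _; set s2 := nystrom_sum _ _ _ _ _ _.
(* Here [s1] is K_h u and [s2] is K_h e: consistency at z, then the propagated error at the
   nodes. *)
rewrite (_ : u z - _ = lam^-1 * ((intop O k u z - s1) - s2)); last by field.
rewrite normrM normfV (_ : _ * Cnorm q O u = `|lam|^-1 * (tau + B * (tau / kappa))).
  apply: ler_wpM2l; first by rewrite invr_ge0.
  rewrite (le_trans (ler_normB _ _))// lerD//; first exact: tauP.
  by apply: sum_le => //; rewrite divr_ge0// ltW.
by rewrite /tau; ring.
Qed.
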